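(* For the special trivector $$\sigma_0=[025]+[136]+[247]+[308]+[419]+[097]+[158]+[269]+[375]+[486]\in\bigwedge^3V_{10}^\vee,$$ the hyperplane section $X_3^{\sigma_0}$ and, hence, the special Debarre--Voisin variety $X_6^{\sigma_0}$ are both smooth (the latter of dimension $4$).
   Context: $V_{10}$ is a $10$-dimensional complex vector space, $(x_0,\dots,x_9)$ is a basis of $V_{10}^\vee$, and $[ijk]=x_i\wedge x_j\wedge x_k$. $X_3^{\sigma_0}=\{[V_3]\in\mathrm{Gr}(3,V_{10})\mid\sigma_0|_{V_3}=0\}$ is the Plücker hyperplane section of $\mathrm{Gr}(3,V_{10})$ defined by $\sigma_0$, of dimension $20$. $X_6^{\sigma_0}=\{[V_6]\in\mathrm{Gr}(6,V_{10})\mid\sigma_0|_{V_6}=0\}$, with its scheme structure as the zero locus of the section of $\bigwedge^3\mathcal U^\vee$ induced by $\sigma_0$ ($\mathcal U$ the tautological rank-$6$ subbundle); its expected dimension is $4$. *)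

(* Defs.v *)
From HB Require Import structures.
From mathcomp Require Import all_boot all_order all_fingroup all_algebra.
From mathcomp Require Import reals complex mpoly.

Set Implicit Arguments.
Unset Strict Implicit.
Unset Printing Implicit Defensive.

Import GRing.Theory.
Local Open Scope ring_scope.

Section AffineSmoothness.
Variables (K : closedFieldType) (n : nat).
Implicit Types (fs gs : seq {mpoly K[n]}) (f h : {mpoly K[n]}).

Definition in_ideal fs f : Prop :=
  exists c : 'I_(size fs) -> {mpoly K[n]},
    f = \sum_(i < size fs) c i * fs`_i.

Definition same_ideal_near (p : 'I_n -> K) fs gs : Prop :=
  exists h, [/\ h.@[p] != 0,
    forall f, f \in fs -> in_ideal gs (h * f) &
    forall g, g \in gs -> in_ideal fs (h * g)].

Definition jacobian gs (p : 'I_n -> K) : 'M[K]_(size gs, n) :=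
  \matrix_(i < size gs, j < n) ((gs`_i)^`M(j)).@[p].

(* The closed subscheme fs = 0 of affine n-space is smooth of dimension d at
   its K-point p: around p its ideal is generated by n - d polynomials whose
   differentials at p are linearly independent.  This is the definition of
   Bosch-Luetkebohmert-Raynaud, Neron Models, 2.2/3; the gs need not be
   extracted from fs, and d is not presupposed to be the dimension. *)
Definition smooth_at (fs : seq {mpoly K[n]}) (p : 'I_n -> K) (d : nat) : Prop :=
  exists gs, [/\ (size gs + d = n)%N,
    same_ideal_near p fs gs & row_free (jacobian gs p)].

End AffineSmoothness.

(* An element of the third exterior power of the dual of K^n is given by the
   coefficients t (a, b, c) of the associated alternating trilinear form.  The type does not enforce alternation; it holds
   for the combinations of wedge3 i j k that are used. *)
Definition trivector (K : nzRingType) (n : nat) :=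
  {ffun 'I_n * 'I_n * 'I_n -> K}.

(* x_i /\ x_j /\ x_k, normalised so that its value on (u, v, w) is the
   determinant of the x_i, x_j, x_k coordinates of u, v, w. *)
Definition wedge3 (K : comNzRingType) (n : nat) (i j k : 'I_n) :
    trivector K n :=
  [ffun abc : 'I_n * 'I_n * 'I_n =>
    \det (\matrix_(p < 3, q < 3)
      (tnth [tuple i; j; k] p
         == tnth [tuple abc.1.1; abc.1.2; abc.2] q)%:R : 'M[K]_3)].

Definition trieval (A : comNzRingType) (n : nat) (t : trivector A n)
    (u v w : 'rV[A]_n) : A :=
  \sum_a \sum_b \sum_c t (a, b, c) * (u 0 a * v 0 b * w 0 c).

Section GrassmannianZeroLocus.
Variables (K : closedFieldType) (k m : nat).
Implicit Types (t : trivector K (k + m)) (s : 'S_(k + m)).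

(* Standard affine charts of Gr(k, k + m): the subspaces with a (unique) basis
   whose coordinates in the k columns selected by s form the identity matrix.
   The other k * m coordinates are the chart coordinates. *)
Definition chart_mx (A : nzRingType) s (X : 'M[A]_(k, m)) : 'M[A]_(k, k + m) :=
  col_perm s (row_mx 1%:M X).

Definition chart_point s (p : 'I_(k * m) -> K) : {vspace 'rV[K]_(k + m)} :=
  <<[seq row i (chart_mx s (\matrix_(i, j) p (mxvec_index i j)))
      | i : 'I_k]>>%VS.

Definition generic_mx s : 'M[{mpoly K[k * m]}]_(k, k + m) :=
  chart_mx s (\matrix_(i, j) 'X_(mxvec_index i j)).

(* The rows of generic_mx trivialise the tautological subbundle U over the
   chart; these are the components, in the induced trivialisation of the third
   exterior power of the dual of U, of the section defined by t.  For k = 3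
   this is the single local equation of the Pluecker hyperplane section. *)
Definition chart_equations t s : seq {mpoly K[k * m]} :=
  [seq trieval [ffun abc => (t abc)%:MP_[k * m]] (row abc.1.1 (generic_mx s))
         (row abc.1.2 (generic_mx s)) (row abc.2 (generic_mx s))
    | abc : 'I_k * 'I_k * 'I_k <- enum {: 'I_k * 'I_k * 'I_k}
    & (abc.1.1 < abc.1.2 < abc.2)%N].

Definition zero_locus t (W : {vspace 'rV[K]_(k + m)}) : Prop :=
  \dim W = k /\
  forall u v w, u \in W -> v \in W -> w \in W -> trieval t u v w = 0.

(* As K is algebraically closed, smoothness can be tested at K-points. *)
Definition smooth_zero_locus t (d : nat) : Prop :=
  (exists W, zero_locus t W) /\
  forall W, zero_locus t W ->
    exists s p, W = chart_point s p /\ smooth_at (chart_equations t s) p d.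

End GrassmannianZeroLocus.

Local Notation "[w i , j , k ]" :=
  (wedge3 _ (@Ordinal 10 i isT) (@Ordinal 10 j isT) (@Ordinal 10 k isT))
  (i, j, k at level 0).

Definition sigma0 (K : comNzRingType) : trivector K 10 :=
  [w 0, 2, 5] + [w 1, 3, 6] + [w 2, 4, 7] + [w 3, 0, 8] + [w 4, 1, 9]
  + [w 0, 9, 7] + [w 1, 5, 8] + [w 2, 6, 9] + [w 3, 7, 5] + [w 4, 8, 6].

(* Main.v *)
Require Import Defs.
From mathcomp Require Import all_boot all_order all_fingroup all_algebra.
From mathcomp Require Import reals complex mpoly.
From mathcomp Require Import ring zify.

Set Implicit Arguments.
Unset Strict Implicit.
Unset Printing Implicit Defensive.

Import Order.TTheory GRing.Theory Num.Theory.
Local Open Scope ring_scope.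

(* A singular point of X_3 is a 3-space U with sigma0(U, U, -) = 0.  Its Pluecker
   coordinates satisfy linear relations which, with respect to the
   Z/11-grading of V_10 with weights (1, 9, 4, 3, 5, 6, 10, 2, 7, 8) preserved by
   sigma0, leave two parameters in every nonzero weight and none in weight
   zero; the three-term Pluecker relations then contain the squares of these
   parameters.  The cyclic symmetry i -> i + 1 mod 5 on x_i and x_(5+i) reduces
   the ten nonzero weights to two.

   A singular point V of X_6 gives a nonzero trivector w on V annihilated by all
   the forms sigma0(-, -, y) on V.  Hitchin's endomorphism of V attached to w is
   skew for these forms and has scalar square, and in each case its image,
   eigenspaces or kernel produce a 3-space U in V with sigma0(U, U, -) = 0. *)

(** Both halves rest on one fact: no three-space is isotropic for all the forms sigma0(-, -, y). For
    X_6 the dimensions leave no slack. Isotropic spaces have dimension at most 2, so Hitchin's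
    endomorphism H of the 6-space V has square zero, and the delicate case is H of rank one. There
    an isotropic plane in a 4-space is needed, and it exists because the quotient of V_10 by V
    supplies only 10 - 6 = 4 forms, against 6 bivectors. If H = 0, the trivector is decomposable and
    the three-space it spans is isotropic. The vanishing of Pluecker coordinates is certified by
    integer identities in which a coordinate is multiplied by 33, or its square by 11; dividing by
    these uses characteristic zero. *)

Definition alt3 (C : zmodType) (f : nat -> nat -> nat -> C) (a b c : nat) : C :=
  if (a < b)%N then
    if (b < c)%N then f a b c else if (c < a)%N then f c a b
    else if (a < c < b)%N then - f a c b else 0
  else if (b < a)%N then
    if (a < c)%N then - f b a c else if (c < b)%N then - f c b a
    else if (b < c < a)%N then f b c a else 0
  else 0.

(** [alt3] computes on numerals, so rewriting with this equation turns every coordinate into a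
    signed one at an increasing triple, and [ring] then meets independent unknowns. This is why the
    indices are natural numbers. *)
Lemma alt3E (C : numFieldType) (f : nat -> nat -> nat -> C) :
  (forall a b c, f a b c = - f b a c) -> (forall a b c, f a b c = - f a c b) ->
  forall a b c, f a b c = alt3 f a b c.
Proof.
move=> f12 f23 a b c.
have eq0 x : x = - x -> x = 0 :> C.
  by move/eqP; rewrite -addr_eq0 -mulr2n mulrn_eq0 => /eqP.
have faa x y : f x x y = 0 by apply: eq0; exact: f12.
have fbb x y : f x y y = 0 by apply: eq0; exact: f23.
have faba x y : f x y x = 0 by rewrite f23 faa oppr0.
rewrite /alt3; case: (ltngtP a b) => [ab|ba|<-]; last by rewrite faa.
  case: (ltngtP b c) => [//|cb|<-].
  - case: (ltngtP a c) => [ac|//|<-] /=; by [rewrite f23 | rewrite f12 f23 opprK | rewrite faba].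
  - by rewrite ltnNge (ltnW ab) /= andbF fbb.
case: (ltngtP a c) => [ac|ca|<-].
- by rewrite f12.
- case: (ltngtP b c) => [bc|cb|<-] /=.
  + by rewrite f12 f23 opprK.
  + by rewrite f23 f12 f23 opprK.
  + by rewrite fbb.
- by rewrite ltnNge (ltnW ba) /= andbF faba.
Qed.

(** * Pluecker coordinates of isotropic three-spaces *)

Section MinorRelations.
Variable C : numFieldType.
Implicit Type g : nat -> nat -> nat -> C.

Local Notation "g `( a , b , c )" := (g a%N b%N c%N) (at level 2, only parsing).

(* The indices of the coordinates x_i and y_i = x_(5+i), with i modulo 5. *)
Definition x_ (i : nat) : nat := i %% 5.
Definition y_ (i : nat) : nat := 5 + i %% 5.
Definition rot (k n : nat) : nat := if (n < 5)%N then x_ (n + k) else y_ (n + k).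

Lemma rot_x k i : rot k (x_ i) = x_ (i + k).
Proof. by rewrite /rot /x_ ltn_pmod // modnDml. Qed.

Lemma rot_y k i : rot k (y_ i) = y_ (i + k).
Proof. by rewrite /rot /y_ ltnNge leq_addr /= -addnA modnDl modnDml. Qed.

(* sigma0 is the sum over i of x_i /\ x_(i+2) /\ y_i + x_i /\ y_(i+4) /\ y_(i+2);
   linx and liny contract it with g in two arguments, leaving x_i or y_i free. *)
Definition linx g i d :=
  g d (x_ (i + 2)) (y_ i) + g d (y_ (i + 3)) (x_ (i + 3))
  + g d (y_ (i + 4)) (y_ (i + 2)).
Definition liny g i d :=
  g d (x_ i) (x_ (i + 2)) + g d (y_ (i + 3)) (x_ (i + 1))
  + g d (x_ (i + 3)) (y_ (i + 2)).
Definition three_term g a b c d e :=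
  g a b c * g a d e - g a b d * g a c e + g a b e * g a c d.

Definition isotropic_minors g : Prop :=
  [/\ forall a b c, g a b c = - g b a c, forall a b c, g a b c = - g a c b,
      forall i d, linx g i d = 0, forall i d, liny g i d = 0
    & forall a b c d e, three_term g a b c d e = 0].

Definition rotate k g := fun a b c => g (rot k a) (rot k b) (rot k c).

(** One step of rotation multiplies the weights by 9, whose powers are the nonzero squares modulo
    11. The nonzero weights thus form two orbits, squares and nonsquares, represented by 1 and 2. *)
Lemma isotropic_minors_rot k g :
  isotropic_minors g -> isotropic_minors (rotate k g).
Proof.
move=> [g12 g23 gx gy gpl]; split=> [a b c|a b c|i d|i d|a b c d e].
- exact: g12.
- exact: g23.
- have := gx (i + k)%N (rot k d).
  by rewrite /linx /rotate !rot_x !rot_y ![(i + k + _)%N]addnAC.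
- have := gy (i + k)%N (rot k d).
  by rewrite /liny /rotate !rot_x !rot_y ![(i + k + _)%N]addnAC.
- exact: gpl.
Qed.

Lemma eq_of_sub (a b l r : C) : l = r -> a - b = l - r -> a = b.
Proof. by move=> ->; rewrite subrr => /subr0_eq. Qed.

Lemma eq_of_subN (a b l r : C) : l = r -> a - b = r - l -> a = b.
Proof. by move=> ->; rewrite subrr => /subr0_eq. Qed.

Ltac sorted_ring gE e :=
  rewrite /linx /liny /rotate !gE /alt3 /= ?e; ring.
Tactic Notation "linear_from" constr(H) "rewriting" constr(e) :=
  match goal with gE : forall a b c, _ = alt3 _ a b c |- _ =>
    first [ apply: (eq_of_sub H); sorted_ring gE e
          | apply: (eq_of_subN H); sorted_ring gE e ] end.
Tactic Notation "linear_from" constr(H) := linear_from H rewriting addr0.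

Lemma weight1_linear g : isotropic_minors g ->
  g`(4, 6, 9) = - g`(0, 4, 5) /\
  g`(3, 7, 8) = - g`(0, 2, 8) /\
  g`(2, 5, 7) = g`(0, 2, 8) /\
  g`(5, 6, 8) = - g`(0, 4, 5) /\
  g`(1, 2, 6) = g`(0, 2, 8) *+ 2 /\
  g`(1, 5, 9) = g`(0, 2, 8) + g`(0, 4, 5) /\
  g`(0, 3, 9) = g`(0, 2, 8) + g`(0, 4, 5) *+ 2 /\
  g`(0, 1, 7) = - g`(0, 2, 8) *+ 2 /\
  g`(2, 3, 4) = - g`(0, 2, 8) - g`(0, 4, 5) *+ 2.
Proof.
move=> [g12 g23 gx gy _]; have gE := alt3E g12 g23.
have e469 : g`(4, 6, 9) = - g`(0, 4, 5).
  by linear_from (gx 2%N 4%N).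
have e378 : g`(3, 7, 8) = - g`(0, 2, 8).
  by linear_from (gy 0%N 8%N).
have e257 : g`(2, 5, 7) = g`(0, 2, 8).
  by linear_from (gx 0%N 7%N) rewriting (e378).
have e568 : g`(5, 6, 8) = - g`(0, 4, 5).
  by linear_from (gx 1%N 6%N) rewriting (e469).
have e126 : g`(1, 2, 6) = g`(0, 2, 8) *+ 2.
  by linear_from (gx 3%N 2%N) rewriting (e257).
have e159 : g`(1, 5, 9) = g`(0, 2, 8) + g`(0, 4, 5).
  by linear_from (gx 4%N 5%N) rewriting (e257, e568).
have e039 : g`(0, 3, 9) = g`(0, 2, 8) + g`(0, 4, 5) *+ 2.
  by linear_from (gy 3%N 9%N) rewriting (e159, e469).
have e017 : g`(0, 1, 7) = - g`(0, 2, 8) *+ 2.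
  by linear_from (gy 4%N 1%N) rewriting (e126).
have e234 : g`(2, 3, 4) = - g`(0, 2, 8) - g`(0, 4, 5) *+ 2.
  by linear_from (gy 2%N 3%N) rewriting (e039).
by do !split.
Qed.

Lemma weight2_linear g : isotropic_minors g ->
  g`(0, 4, 8) = - g`(0, 1, 3) + g`(0, 2, 9) /\
  g`(2, 3, 5) = - g`(0, 2, 9) /\
  g`(1, 4, 6) = g`(0, 1, 3) /\
  g`(0, 6, 7) = g`(0, 1, 3) /\
  g`(3, 7, 9) = g`(0, 2, 9) /\
  g`(4, 5, 7) = g`(0, 1, 3) *+ 2 - g`(0, 2, 9) /\
  g`(1, 8, 9) = g`(0, 2, 9) *+ 2 /\
  g`(5, 6, 9) = g`(0, 1, 3) *+ 2 - g`(0, 2, 9) /\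
  g`(2, 7, 8) = - g`(0, 2, 9) *+ 2.
Proof.
move=> [g12 g23 gx gy _]; have gE := alt3E g12 g23.
have e048 : g`(0, 4, 8) = - g`(0, 1, 3) + g`(0, 2, 9).
  by linear_from (gy 1%N 0%N).
have e235 : g`(2, 3, 5) = - g`(0, 2, 9).
  by linear_from (gy 2%N 2%N).
have e146 : g`(1, 4, 6) = g`(0, 1, 3).
  by linear_from (gy 3%N 1%N).
have e067 : g`(0, 6, 7) = g`(0, 1, 3).
  by linear_from (gy 4%N 6%N) rewriting (e146).
have e379 : g`(3, 7, 9) = g`(0, 2, 9).
  by linear_from (gx 0%N 3%N) rewriting (e235).
have e457 : g`(4, 5, 7) = g`(0, 1, 3) *+ 2 - g`(0, 2, 9).
  by linear_from (gx 3%N 4%N) rewriting (e048, e146).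
have e189 : g`(1, 8, 9) = g`(0, 2, 9) *+ 2.
  by linear_from (gy 0%N 9%N) rewriting (e379).
have e569 : g`(5, 6, 9) = g`(0, 1, 3) *+ 2 - g`(0, 2, 9).
  by linear_from (gx 2%N 5%N) rewriting (e457).
have e278 : g`(2, 7, 8) = - g`(0, 2, 9) *+ 2.
  by linear_from (gx 4%N 8%N) rewriting (e189).
by do !split.
Qed.

(** The coordinates of weight zero are those of the ten terms of sigma0, and the relation with free
    index [d] adds the three whose term contains [d]. This 10 x 10 incidence matrix is invertible;
    the coefficients below are two rows of 33 times its inverse, and the other rows follow by
    rotation. *)
Lemma weight0_vanish_base g : isotropic_minors g ->
  g`(0, 2, 5) = 0 /\ g`(0, 9, 7) = 0.
Proof.
move=> [g12 g23 gx gy _]; have gE := alt3E g12 g23.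
have s025 : g`(0, 2, 5) *+ 33 = 17%:R * linx g 0 0 - linx g 1 1 +
    2%:R * linx g 2 2 - 4%:R * linx g 3 3 + 8%:R * linx g 4 4 +
    14%:R * liny g 0 5 + 5%:R * liny g 1 6 - 10%:R * liny g 2 7 -
    13%:R * liny g 3 8 - 7%:R * liny g 4 9.
  by rewrite /linx /liny !gE /alt3 /=; ring.
have s097 : g`(0, 9, 7) *+ 33 = 14%:R * linx g 0 0 + 5%:R * linx g 1 1 -
    10%:R * linx g 2 2 - 13%:R * linx g 3 3 - 7%:R * linx g 4 4 -
    4%:R * liny g 0 5 + 8%:R * liny g 1 6 + 17%:R * liny g 2 7 - liny g 3 8 +
    2%:R * liny g 4 9.
  by rewrite /linx /liny !gE /alt3 /=; ring.
split; apply/eqP.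
- by move/eqP: s025; rewrite !(gx, gy) !mulr0 !(subr0, addr0) mulrn_eq0.
- by move/eqP: s097; rewrite !(gx, gy) !mulr0 !(subr0, addr0) mulrn_eq0.
Qed.

Lemma weight0_vanish g i : isotropic_minors g ->
  g (x_ i) (x_ (i + 2)) (y_ i) = 0 /\ g (x_ i) (y_ (i + 4)) (y_ (i + 2)) = 0.
Proof.
move=> gP; have := weight0_vanish_base (isotropic_minors_rot i gP).
rewrite /rotate (rot_x i 0) (rot_x i 2) (rot_y i 0) (rot_y i 2) (rot_y i 4).
by rewrite !(addnC _ i) addn0.
Qed.

(** The three-term relations combined here are homogeneous of weight 2, like the squares of the two
    parameters. They also contain products of coordinates of other weights with sum 2; these cancel
    in the combination once each coordinate is written in the two parameters of its own weight,
    which is why linear relations of several rotations are needed. *)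
Lemma weight1_vanish g : isotropic_minors g -> g`(0, 2, 8) = 0 /\ g`(0, 4, 5) = 0.
Proof.
move=> gP; have [g12 g23 _ _ gpl] := gP; have gE := alt3E g12 g23.
have g0 i := weight0_vanish i gP.
have [h469 [h378 [_ [_ [h126 [h159 [h039 _]]]]]]] := weight1_linear
  (isotropic_minors_rot 0 gP).
have e469 : g`(4, 6, 9) = - g`(0, 4, 5) by linear_from h469.
have e378 : g`(3, 7, 8) = - g`(0, 2, 8) by linear_from h378.
have e126 : g`(1, 2, 6) = g`(0, 2, 8) *+ 2 by linear_from h126.
have e159 : g`(1, 5, 9) = g`(0, 2, 8) + g`(0, 4, 5) by linear_from h159.
have e039 : g`(0, 3, 9) = g`(0, 2, 8) + g`(0, 4, 5) *+ 2 by linear_from h039.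
have [_ [h156 [h058 [_ [h049 _]]]]] := weight1_linear (isotropic_minors_rot 3 gP).
have e156 : g`(1, 5, 6) = g`(0, 3, 6) by linear_from h156.
have e058 : g`(0, 5, 8) = g`(0, 3, 6) by linear_from h058.
have e049 : g`(0, 4, 9) = g`(0, 3, 6) *+ 2 by linear_from h049.
have [_ [_ [h169 [_ [_ [_ [_ [h046 _]]]]]]]] := weight1_linear
  (isotropic_minors_rot 4 gP).
have e169 : g`(1, 6, 9) = g`(1, 4, 7) by linear_from h169.
have e046 : g`(0, 4, 6) = - g`(1, 4, 7) *+ 2 by linear_from h046.
have [h048 [_ [h146 [_ [h379 [_ [_ [h569 _]]]]]]]] := weight2_linear
  (isotropic_minors_rot 0 gP).
have e048 : g`(0, 4, 8) = - g`(0, 1, 3) + g`(0, 2, 9) by linear_from h048.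
have e146 : g`(1, 4, 6) = g`(0, 1, 3) by linear_from h146.
have e379 : g`(3, 7, 9) = g`(0, 2, 9) by linear_from h379.
have e569 : g`(5, 6, 9) = g`(0, 1, 3) *+ 2 - g`(0, 2, 9) by linear_from h569.
have [_ [h346 [_ [_ [h458 [_ [_ [_ h389]]]]]]]] := weight2_linear
  (isotropic_minors_rot 1 gP).
have e346 : g`(3, 4, 6) = - g`(1, 3, 5) by linear_from h346.
have e458 : g`(4, 5, 8) = - g`(1, 3, 5) by linear_from h458.
have e389 : g`(3, 8, 9) = - g`(1, 3, 5) *+ 2 by linear_from h389.
have [_ [_ [_ [_ [_ [_ [h356 [_ h459]]]]]]]] := weight2_linear
  (isotropic_minors_rot 2 gP).
have e356 : g`(3, 5, 6) = g`(2, 4, 6) *+ 2 by linear_from h356.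
have e459 : g`(4, 5, 9) = g`(2, 4, 6) *+ 2 by linear_from h459.
have [_ [h018 [_ [_ [_ [_ [_ [_ h056]]]]]]]] := weight2_linear
  (isotropic_minors_rot 3 gP).
have e018 : g`(0, 1, 8) = g`(0, 3, 7) by linear_from h018.
have e056 : g`(0, 5, 6) = g`(0, 3, 7) *+ 2 by linear_from h056.
have [_ [_ [_ [h456 [_ [h369 _]]]]]] := weight2_linear (isotropic_minors_rot 4 gP).
have e456 : g`(4, 5, 6) = g`(0, 2, 4) by linear_from h456.
have e369 : g`(3, 6, 9) = - g`(0, 2, 4) *+ 2 - g`(1, 4, 8) by linear_from h369.
have e025 : g`(0, 2, 5) = 0 by linear_from (proj1 (g0 0%N)).
have e038 : g`(0, 3, 8) = 0 by linear_from (proj1 (g0 3%N)).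
have e136 : g`(1, 3, 6) = 0 by linear_from (proj1 (g0 1%N)).
have e149 : g`(1, 4, 9) = 0 by linear_from (proj1 (g0 4%N)).
have e158 : g`(1, 5, 8) = 0 by linear_from (proj2 (g0 1%N)).
have e269 : g`(2, 6, 9) = 0 by linear_from (proj2 (g0 2%N)).
have s028 : g`(0, 2, 8) ^+ 2 *+ 11 = 18%:R * three_term g 8 0 1 4 5 +
    18%:R * three_term g 6 1 3 5 9 + (- 28%:R) * three_term g 6 1 2 4 9 +
    34%:R * three_term g 0 2 4 5 8 + 2%:R * three_term g 6 0 3 4 5 +
    11%:R * three_term g 3 0 7 8 9.
  by rewrite /three_term !gE /alt3 /= ?(e018, e025, e038, e039, e046, e048,
    e056, e058, e126, e136, e146, e156, e158, e169, e269, e346, e356, e369,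
    e378, e379, e389, e456, e458, e469, e569); ring.
have s045 : g`(0, 4, 5) ^+ 2 *+ 11 = 5%:R * three_term g 4 0 5 6 9 +
    10%:R * three_term g 0 2 4 5 8 + (- 8%:R) * three_term g 6 1 2 4 9 +
    6%:R * three_term g 9 1 4 5 6.
  by rewrite /three_term !gE /alt3 /= ?(e025, e046, e048, e049, e058, e126,
    e146, e149, e159, e169, e269, e456, e459, e469, e569); ring.
split; apply/eqP.
- by move/eqP: s028; rewrite !gpl !mulr0 !addr0 mulrn_eq0 expf_eq0.
- by move/eqP: s045; rewrite !gpl !mulr0 !addr0 mulrn_eq0 expf_eq0.
Qed.

(** The same elimination, among three-term relations of weight 4. *)
Lemma weight2_vanish g : isotropic_minors g -> g`(0, 1, 3) = 0 /\ g`(0, 2, 9) = 0.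
Proof.
move=> gP; have [g12 g23 _ _ gpl] := gP; have gE := alt3E g12 g23.
have g0 i := weight0_vanish i gP.
have [_ [_ [h257 [_ [h126 [_ [_ [h017 _]]]]]]]] := weight1_linear
  (isotropic_minors_rot 0 gP).
have e257 : g`(2, 5, 7) = g`(0, 2, 8) by linear_from h257.
have e126 : g`(1, 2, 6) = g`(0, 2, 8) *+ 2 by linear_from h126.
have e017 : g`(0, 1, 7) = - g`(0, 2, 8) *+ 2 by linear_from h017.
have [h057 [_ [_ [h679 _]]]] := weight1_linear (isotropic_minors_rot 1 gP).
have e057 : g`(0, 5, 7) = - g`(0, 1, 6) by linear_from h057.
have e679 : g`(6, 7, 9) = g`(0, 1, 6) by linear_from h679.
have [h168 [_ [_ [h578 [_ [h367 [h026 [_ h014]]]]]]]] := weight1_linear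
  (isotropic_minors_rot 2 gP).
have e168 : g`(1, 6, 8) = - g`(1, 2, 7) by linear_from h168.
have e578 : g`(5, 7, 8) = g`(1, 2, 7) by linear_from h578.
have e367 : g`(3, 6, 7) = - g`(2, 4, 5) + g`(1, 2, 7) by linear_from h367.
have e026 : g`(0, 2, 6) = - g`(2, 4, 5) + g`(1, 2, 7) *+ 2 by linear_from h026.
have e014 : g`(0, 1, 4) = - g`(2, 4, 5) + g`(1, 2, 7) *+ 2 by linear_from h014.
have [_ [h156 [h058 [_ [_ [_ [_ [h345 _]]]]]]]] := weight1_linear
  (isotropic_minors_rot 3 gP).
have e156 : g`(1, 5, 6) = g`(0, 3, 6) by linear_from h156.
have e058 : g`(0, 5, 8) = g`(0, 3, 6) by linear_from h058.
have e345 : g`(3, 4, 5) = g`(0, 3, 6) *+ 2 by linear_from h345.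
have [_ [_ [h169 [_ [h015 [_ [_ [h046 _]]]]]]]] := weight1_linear
  (isotropic_minors_rot 4 gP).
have e169 : g`(1, 6, 9) = g`(1, 4, 7) by linear_from h169.
have e015 : g`(0, 1, 5) = - g`(1, 4, 7) *+ 2 by linear_from h015.
have e046 : g`(0, 4, 6) = - g`(1, 4, 7) *+ 2 by linear_from h046.
have [h048 [h235 [h146 [h067 [h379 [h457 [h189 _]]]]]]] := weight2_linear
  (isotropic_minors_rot 0 gP).
have e048 : g`(0, 4, 8) = - g`(0, 1, 3) + g`(0, 2, 9) by linear_from h048.
have e235 : g`(2, 3, 5) = - g`(0, 2, 9) by linear_from h235.
have e146 : g`(1, 4, 6) = g`(0, 1, 3) by linear_from h146.
have e067 : g`(0, 6, 7) = g`(0, 1, 3) by linear_from h067.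
have e379 : g`(3, 7, 9) = g`(0, 2, 9) by linear_from h379.
have e457 : g`(4, 5, 7) = g`(0, 1, 3) *+ 2 - g`(0, 2, 9) by linear_from h457.
have e189 : g`(1, 8, 9) = g`(0, 2, 9) *+ 2 by linear_from h189.
have [h236 [_ [_ [_ [h157 [h258 [h467 _]]]]]]] := weight2_linear
  (isotropic_minors_rot 3 gP).
have e236 : g`(2, 3, 6) = g`(1, 3, 4) + g`(0, 3, 7) by linear_from h236.
have e157 : g`(1, 5, 7) = - g`(0, 3, 7) by linear_from h157.
have e258 : g`(2, 5, 8) = - g`(1, 3, 4) *+ 2 - g`(0, 3, 7) by linear_from h258.
have e467 : g`(4, 6, 7) = - g`(0, 3, 7) *+ 2 by linear_from h467.
have [_ [_ [_ [_ [_ [_ [_ [_ h167]]]]]]]] := weight2_linear (isotropic_minors_rot 4 gP).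
have e167 : g`(1, 6, 7) = g`(1, 4, 8) *+ 2 by linear_from h167.
have e025 : g`(0, 2, 5) = 0 by linear_from (proj1 (g0 0%N)).
have e079 : g`(0, 7, 9) = 0 by linear_from (proj2 (g0 0%N)).
have e136 : g`(1, 3, 6) = 0 by linear_from (proj1 (g0 1%N)).
have e149 : g`(1, 4, 9) = 0 by linear_from (proj1 (g0 4%N)).
have e357 : g`(3, 5, 7) = 0 by linear_from (proj2 (g0 3%N)).
have e468 : g`(4, 6, 8) = 0 by linear_from (proj2 (g0 4%N)).
have s013 : g`(0, 1, 3) ^+ 2 *+ 11 = (- 6%:R) * three_term g 4 0 1 6 8 +
    8%:R * three_term g 1 4 6 8 9 + (- 5%:R) * three_term g 6 0 1 4 7 +
    (- 10%:R) * three_term g 7 0 3 6 9.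
  by rewrite /three_term !gE /alt3 /= ?(e014, e046, e048, e067, e079, e146,
    e149, e167, e168, e169, e189, e367, e379, e467, e468, e679); ring.
have s029 : g`(0, 2, 9) ^+ 2 *+ 11 = 4%:R * three_term g 1 0 5 6 7 +
    16%:R * three_term g 1 4 6 8 9 + (- 10%:R) * three_term g 7 0 3 6 9 +
    (- 6%:R) * three_term g 5 0 2 7 8 + (- 12%:R) * three_term g 6 0 1 2 3 +
    (- 11%:R) * three_term g 5 2 3 4 7.
  by rewrite /three_term !gE /alt3 /= ?(e015, e017, e025, e026, e057, e058,
    e067, e079, e126, e136, e146, e149, e156, e157, e167, e168, e169, e189,
    e235, e236, e257, e258, e345, e357, e367, e379, e457, e578, e679); ring.
split; apply/eqP.
- by move/eqP: s013; rewrite !gpl !mulr0 !addr0 mulrn_eq0 expf_eq0.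
- by move/eqP: s029; rewrite !gpl !mulr0 !addr0 mulrn_eq0 expf_eq0.
Qed.

(* The triples of weights 1, 2, and two of weight 0, representing all the
   triples up to rotation. *)
Definition triple_orbits : seq (nat * nat * nat) := [::
   (0, 2, 8); (0, 4, 5); (4, 6, 9); (3, 7, 8); (2, 5, 7); (5, 6, 8); (1,
   2, 6); (1, 5, 9); (0, 3, 9); (0, 1, 7); (2, 3, 4); (0, 1, 3); (0, 2,
   9); (0, 4, 8); (2, 3, 5); (1, 4, 6); (0, 6, 7); (3, 7, 9); (4, 5, 7);
   (1, 8, 9); (5, 6, 9); (2, 7, 8); (0, 2, 5); (0, 9, 7)].

Lemma orbit_vanish g t : isotropic_minors g ->
  t \in triple_orbits -> g t.1.1 t.1.2 t.2 = 0.
Proof.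
move=> gP.
have [a1 b1] := weight1_vanish gP; have [a2 b2] := weight2_vanish gP.
have [a0 b0] := weight0_vanish_base gP.
have [l469 [l378 [l257 [l568 [l126 [l159 [l039 [l017 l234]]]]]]]] := weight1_linear gP.
have [l048 [l235 [l146 [l067 [l379 [l457 [l189 [l569 l278]]]]]]]] := weight2_linear gP.
move=> tT; apply/eqP; move: t tT; apply/allP => /=.
by rewrite l469 l378 l257 l568 l126 l159 l039 l017 l234 l048 l235 l146 l067 l379
  l457 l189 l569 l278 !a1 !b1 !a2 !b2 a0 b0 !(mul0rn, oppr0, addr0, subr0,
  eqxx).
Qed.

Definition rearrangements (a b c : nat) : seq (nat * nat * nat) :=
  [:: (a, b, c); (b, a, c); (a, c, b); (b, c, a); (c, a, b); (c, b, a)].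

Lemma rearrangements_vanish g a b c t :
  (forall a b c, g a b c = - g b a c) -> (forall a b c, g a b c = - g a c b) ->
  g a b c = 0 -> t \in rearrangements a b c -> g t.1.1 t.1.2 t.2 = 0.
Proof.
move=> g12 g23 g0 tabc; apply/eqP; move: t tabc; apply/allP => /=.
have ba : g b a c = 0 by rewrite g12 g0 oppr0.
have ac : g a c b = 0 by rewrite g23 g0 oppr0.
have bc : g b c a = 0 by rewrite g23 ba oppr0.
have ca : g c a b = 0 by rewrite g12 ac oppr0.
by rewrite g0 ba ac bc ca (g23 c b a) ca oppr0 eqxx.
Qed.

Lemma triple_orbits_cover :
  all (fun a => all (fun b => all (fun c => (a < b < c)%N ==>
    has (fun k => has (fun t => (a, b, c) \in
          rearrangements (rot k t.1.1) (rot k t.1.2) (rot k t.2))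
      triple_orbits) (iota 0 5)) (iota 0 10)) (iota 0 10)) (iota 0 10).
Proof. by vm_compute. Qed.

Lemma isotropic_minors_vanish g a b c : isotropic_minors g ->
  (a < 10)%N -> (b < 10)%N -> (c < 10)%N -> g a b c = 0.
Proof.
move=> gP; have [g12 g23 _ _ _] := gP.
have sorted0 d e f : (d < 10)%N -> (e < 10)%N -> (f < 10)%N -> (d < e < f)%N ->
    g d e f = 0.
  move=> d10 e10 f10 def.
  have /allP/(_ d) := triple_orbits_cover; rewrite mem_iota => /(_ d10).
  move=> /allP/(_ e); rewrite mem_iota => /(_ e10).
  move=> /allP/(_ f); rewrite mem_iota => /(_ f10); rewrite def implyTb.
  move=> /hasP[k _ /hasP[t tT def_perm]].
  have gt0 := orbit_vanish (isotropic_minors_rot k gP) tT.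
  exact: (rearrangements_vanish g12 g23 gt0 def_perm).
move=> a10 b10 c10; rewrite (alt3E g12 g23) /alt3.
case: ltnP => [ab|_].
  case: ltnP => [bc|_]; first by rewrite sorted0 ?ab ?bc.
  case: ltnP => [ca|_]; first by rewrite sorted0 ?ab ?ca.
  by case: ifP => // h; rewrite sorted0 ?oppr0.
case: ltnP => [ba|//].
case: ltnP => [ac|_]; first by rewrite sorted0 ?ba ?ac ?oppr0.
case: ltnP => [cb|_]; first by rewrite sorted0 ?ba ?cb ?oppr0.
by case: ifP => // h; rewrite sorted0.
Qed.

End MinorRelations.

(** * Hitchin's endomorphism of a 6-space with a trivector *)

Definition alt2 (C : zmodType) (g : nat -> nat -> C) (a b : nat) : C :=
  if (a < b)%N then g a b else if (b < a)%N then - g b a else 0.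

Lemma alt2E (C : numFieldType) (g : nat -> nat -> C) :
  (forall a b, g a b = - g b a) -> forall a b, g a b = alt2 g a b.
Proof.
move=> g12 a b; rewrite /alt2; case: ltngtP => // <-.
by move/eqP: (g12 a a); rewrite -addr_eq0 -mulr2n mulrn_eq0 => /eqP.
Qed.

Section HitchinEndomorphism.
Variable C : numFieldType.
Implicit Types (f : nat -> nat -> nat -> C) (g : nat -> nat -> C).

(* Up to sign, the coefficient of (i_j w) /\ w that omits the index i, where i_j
   is contraction and w the trivector with coordinates f. *)
Definition hitchin f (i j : nat) : C :=
  let w := alt3 f in let a := bump i 0 in let b := bump i 1 in
  let c := bump i 2 in let d := bump i 3 in let e := bump i 4 in
  let s :=
    w j a b * w c d e - w j a c * w b d e
   + w j a d * w b c e - w j a e * w b c d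
   + w j b c * w a d e - w j b d * w a c e
   + w j b e * w a c d + w j c d * w a b e
   - w j c e * w a b d + w j d e * w a b c in
  if odd i then - s else s.

(** Up to normalisation, the quartic invariant of trivectors in six variables. *)
Definition hitchin_scalar f : C :=
  \sum_(k < 6) hitchin f 0 k * hitchin f k 0.

(** A generic trivector on a 6-space is the sum of two decomposable ones on complementary
    three-spaces, on which H acts by opposite scalars. This explains the identity, which is verified
    entry by entry in the twenty coordinates. *)
Lemma hitchin_sqr f (i j : 'I_6) :
  \sum_(k < 6) hitchin f i k * hitchin f k j = hitchin_scalar f *+ (i == j).
Proof.
case: i j => [i i6] [j j6]; rewrite -val_eqE /= /hitchin_scalar.
rewrite !big_ord_recl !big_ord0 /=.
case: i i6 => [|[|[|[|[|[|i]]]]]] i6; last by [].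
all: case: j j6 => [|[|[|[|[|[|j]]]]]] j6; try by [].
all: rewrite /hitchin /alt3 /=.
all: ring.
Qed.

(** Let t be the vector obtained by contracting the 2-form [g] into the trivector w. The (i, j)
    entry of H g + g H^T is, up to sign, the coefficient of t /\ w at the other four indices, so it
    vanishes with t. *)
Lemma hitchin_skew f g (i j : 'I_6) : (i < j)%N ->
  (forall k : 'I_6, \sum_(b < 6) \sum_(c < 6) alt3 f k b c * alt2 g b c = 0) ->
  \sum_(k < 6) hitchin f i k * alt2 g k j + \sum_(k < 6) alt2 g i k * hitchin f j k
  = 0.
Proof.
move=> ltij t0.
have {}t0 k : (k < 6)%N ->
    \sum_(b < 6) \sum_(c < 6) alt3 f k b c * alt2 g b c = 0.
  by move=> k6; exact: (t0 (Ordinal k6)).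
pose t k := \sum_(b < 6) \sum_(c < 6) alt3 f k b c * alt2 g b c.
(* [o] enumerates in increasing order the four indices other than [i] and [j]. *)
pose o p := bump i (bump (unbump i j) p); pose a := o 0%N; pose b := o 1%N.
pose c := o 2%N; pose d := o 3%N.
transitivity (let s := t a * alt3 f b c d - t b * alt3 f a c d
   + t c * alt3 f a b d - t d * alt3 f a b c in
  if odd (i + j) then s else - s);
  last first.
  have o6 p : (p < 4)%N -> (o p < 6)%N.
    move=> p4; rewrite /o /bump.
    by case: (i <= _)%N; case: (_ <= p)%N => //=; rewrite ?add0n ?add1n ltnW // ?ltnS ltnW.
  by rewrite /t !t0 ?o6 // !mul0r subrr add0r subrr /= oppr0 if_same.
rewrite {}/a {}/b {}/c {}/d {}/o {}/t {t0}; case: i j ltij => [i i6] [j j6] /= ltij.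
rewrite !big_ord_recl !big_ord0 /=.
case: i i6 ltij => [|[|[|[|[|[|i]]]]]] i6; last by [].
all: case: j j6 => [|[|[|[|[|[|j]]]]]] j6; try by [].
all: move=> _; rewrite /hitchin /unbump /alt3 /alt2 /=.
all: ring.
Qed.

End HitchinEndomorphism.

(** * Decomposability when Hitchin's endomorphism vanishes *)

Section ThreeTermRelations.
Variable C : numFieldType.
Implicit Types (f : nat -> nat -> nat -> C) (G : nat -> nat -> nat -> nat -> C).

Lemma alternating4_eq0 G :
  (forall a b c d, G a b c d = - G b a c d) ->
  (forall a b c d, G a b c d = - G a c b d) ->
  (forall a b c d, G a b c d = - G a b d c) ->
  (forall a b c d, (a < b < c)%N -> (c < d < 6)%N -> G a b c d = 0) ->
  forall a b c d, (a < 6)%N -> (b < 6)%N -> (c < 6)%N -> (d < 6)%N ->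
  G a b c d = 0.
Proof.
move=> G12 G23 G34 G0.
have eq0 x : x = - x -> x = 0 :> C.
  by move/eqP; rewrite -addr_eq0 -mulr2n mulrn_eq0 => /eqP.
have aa a c d : G a a c d = 0 by apply: eq0; exact: G12.
have bb a b d : G a b b d = 0 by apply: eq0; exact: G23.
have cc a b c : G a b c c = 0 by apply: eq0; exact: G34.
have abc0 a b c d : (a < b < c)%N -> (c < 6)%N -> (d < 6)%N -> G a b c d = 0.
  move=> /andP[ab bc] c6 d6; case: (ltngtP c d) => [cd|dc|<-]; last exact: cc.
    by rewrite G0 ?ab ?bc ?cd.
  rewrite G34; case: (ltngtP b d) => [bd|db|<-]; last by rewrite bb oppr0.
    by rewrite G0 ?ab ?bd ?dc ?oppr0.
  rewrite G23; case: (ltngtP a d) => [ad|da|<-]; last by rewrite aa !oppr0.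
    by rewrite G0 ?ad ?db ?bc ?c6 ?oppr0.
  by rewrite G12 G0 ?da ?ab ?bc ?c6 ?oppr0.
have ab0 a b c d : (a < b)%N -> (b < 6)%N -> (c < 6)%N -> (d < 6)%N ->
    G a b c d = 0.
  move=> ab b6 c6 d6; case: (ltngtP b c) => [bc|cb|<-]; last exact: bb.
    by rewrite abc0 ?ab ?bc.
  rewrite G23; case: (ltngtP a c) => [ac|ca|<-]; last by rewrite aa oppr0.
    by rewrite abc0 ?ac ?cb ?oppr0.
  by rewrite G12 abc0 ?ca ?ab ?oppr0.
move=> a b c d a6 b6 c6 d6; case: (ltngtP a b) => [ab|ba|<-]; last exact: aa.
  exact: ab0.
by rewrite G12 ab0 ?oppr0.
Qed.

Lemma double_eq0 (x y : C) : y = 0 -> x *+ 2 = y -> x = 0.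
Proof. by move=> -> /eqP; rewrite mulrn_eq0 => /eqP. Qed.

Lemma double_oppr_eq0 (x y : C) : y = 0 -> x *+ 2 = - y -> x = 0.
Proof. by move=> y0; apply: double_eq0; rewrite y0 oppr0. Qed.

(** If i, a, b, c, d are distinct, the missing index e is 15 minus their sum. In the entry (e, i) of
    H the surviving terms have [i] in both factors and agree in pairs, so the entry is up to sign
    twice the three-term expression. That expression is alternating in a, b, c, d, and it is
    identically zero if one of them is [i]. *)
Lemma hitchin0_three_term f :
  (forall i j, (i < 6)%N -> (j < 6)%N -> hitchin f i j = 0) ->
  forall i a b c d, (i < 6)%N -> (a < 6)%N -> (b < 6)%N -> (c < 6)%N ->
  (d < 6)%N ->
  alt3 f i a b * alt3 f i c d - alt3 f i a c * alt3 f i b d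
  + alt3 f i a d * alt3 f i b c = 0.
Proof.
move=> hf i a b c d i6 a6 b6 c6 d6.
have altC x y z : alt3 f x y z = - alt3 f x z y.
  rewrite /alt3; case: (ltngtP x y); case: (ltngtP x z); case: (ltngtP y z);
    by rewrite ?opprK ?oppr0 //=; lia.
pose G a b c d := alt3 f i a b * alt3 f i c d - alt3 f i a c * alt3 f i b d
  + alt3 f i a d * alt3 f i b c.
apply: (@alternating4_eq0 G); rewrite /G // => {a b c d a6 b6 c6 d6} a b c d.
- by rewrite (altC i b a) ; ring.
- by rewrite (altC i c b); ring.
- by rewrite (altC i d c); ring.
move=> /andP[ab bc] /andP[cd d6].
(* The remaining index, whenever the other five are distinct. *)
have := hf (15 - (i + a + b + c + d))%N i.
case: d cd d6 => [|[|[|[|[|[|d]]]]]] cd d6; try by [].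
all: case: c bc cd => [|[|[|[|[|c]]]]] bc cd; try by [].
all: case: b ab bc => [|[|[|[|b]]]] ab bc; try by [].
all: case: a ab => [|[|[|a]]] ab; try by [].
all: case: i i6 {G altC hf} => [|[|[|[|[|[|i]]]]]] i6; try by [].
all: rewrite /hitchin /alt3 /=.
all: try (by move=> _; ring).
all: move=> /(_ isT isT) h.
all: by [apply: (double_eq0 h); ring | apply: (double_oppr_eq0 h); ring].
Qed.

End ThreeTermRelations.

(** * Planes isotropic for four skew forms on a 4-space *)

Section SkewForms.
Variable C : numClosedFieldType.

Lemma exists_row_free_sub k m n (A : 'M[C]_(m, n)) : (k <= \rank A)%N ->
  exists2 Q : 'M_(k, n), row_free Q & (Q <= A)%MS.
Proof.
move=> kA; exists (pid_mx k *m row_base A); last first.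
  by rewrite (submx_trans (submxMl _ _)) // eq_row_base.
by rewrite /row_free mxrankMfree ?row_base_free // rank_pid_mx.
Qed.

Lemma skew_form_diag n (phi : 'M[C]_n) (u : 'rV_n) : phi^T = - phi ->
  u *m phi *m u^T = 0.
Proof.
move=> phiT; set z := _ *m _.
have : z^T = - z by rewrite /z !trmx_mul trmxK phiT mulNmx mulmxN mulmxA.
rewrite [z]mx11_scalar tr_scalar_mx => /matrixP/(_ 0 0); rewrite !mxE eqxx mulr1n.
move/eqP; rewrite -addr_eq0 -mulr2n mulrn_eq0 => /eqP ->.
by rewrite raddf0.
Qed.

Lemma isotropic_col_mx r s n (phi : 'M[C]_n) (A : 'M_(r, n)) (B : 'M_(s, n)) :
  phi^T = - phi -> A *m phi *m A^T = 0 -> B *m phi *m B^T = 0 ->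
  A *m phi *m B^T = 0 -> col_mx A B *m phi *m (col_mx A B)^T = 0.
Proof.
move=> phiT AA BB AB; rewrite tr_col_mx mul_col_mx mul_col_row AA AB BB.
suff -> : B *m phi *m A^T = 0 by rewrite /block_mx !row_mx0 col_mx0.
apply: trmx_inj; rewrite !trmx_mul trmxK phiT mulNmx mulmxN mulmxA AB.
by rewrite oppr0 trmx0.
Qed.


Local Notation "p `[ a , b ]" := (p a%N b%N) (at level 2, only parsing).

(** For skew 4 x 4 matrices, P G P^T is the sum of P, with coefficient the pairing of P and G, and
    of the dual of G, with coefficient the Pfaffian of P up to sign. Both coefficients are zero
    here; [c] and [d] in the proof are the indices complementary to [a] and [b]. *)
Lemma skew_sandwich (p g : nat -> nat -> C) (a b : nat) : (a < b < 4)%N ->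
  p`[0, 1] * p`[2, 3] - p`[0, 2] * p`[1, 3] + p`[0, 3] * p`[1, 2] = 0 ->
  p`[0, 1] * g`[0, 1] + p`[0, 2] * g`[0, 2] + p`[0, 3] * g`[0, 3]
  + p`[1, 2] * g`[1, 2] + p`[1, 3] * g`[1, 3] + p`[2, 3] * g`[2, 3] = 0 ->
  \sum_(d < 4) (\sum_(c < 4) alt2 p a c * alt2 g c d) * alt2 p b d = 0.
Proof.
move=> ab pf pg.
pose c := bump a (bump b.-1 0); pose d := bump a (bump b.-1 1).
have comb x y u v e : x = 0 -> y = 0 -> e = u * x + v * y -> e = 0 :> C.
  by move=> -> ->; rewrite !mulr0 addr0.
apply: (comb _ _ (if odd (a + b) then - alt2 g c d else alt2 g c d)
  (alt2 p a b) _ pf pg); rewrite !big_ord_recl !big_ord0 {}/c {}/d {pf pg} /bump /=.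
case: b ab => [|[|[|[|b]]]] ab; try by rewrite andbF in ab.
all: case: a ab => [|[|[|a]]] ab; try by [].
all: by rewrite /alt2 /=; ring.
Qed.

Lemma quadratic_root (a b c : C) : a != 0 -> exists r, a * r ^+ 2 + b * r + c = 0.
Proof.
move=> a0; have d2 := sqrtCK (b ^+ 2 - 4%:R * a * c).
move: (sqrtC _) d2 => d d2; exists ((d - b) / (2%:R * a)).
transitivity ((d ^+ 2 - (b ^+ 2 - 4%:R * a * c)) / (4%:R * a)); last first.
  by rewrite d2 subrr mul0r.
by field.
Qed.

(* The bivectors of a 4-space killed by four 2-forms contain a pencil, and the
   Pfaffian vanishes at some member of it. *)
Lemma four_skew_forms (phi : 'I_4 -> 'M[C]_4) :
  (forall m, (phi m)^T = - phi m) ->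
  exists2 X : 'M[C]_(2, 4), row_free X & forall m, X *m phi m *m X^T = 0.
Proof.
move=> phiT.
pose pr := [:: (0, 1); (0, 2); (0, 3); (1, 2); (1, 3); (2, 3)]%N.
pose F : 'M[C]_(6, 4) := \matrix_(e, m)
  phi m (inord (nth (0, 0)%N pr e).1) (inord (nth (0, 0)%N pr e).2).
have [|Q Qfree QF] := @exists_row_free_sub 2 _ _ (kermx F).
  by rewrite mxrank_ker (leq_sub2l 6 (rank_leq_col F)).
pose pf (p : 'rV[C]_6) := p 0 (inord 0) * p 0 (inord 5)
  - p 0 (inord 1) * p 0 (inord 4) + p 0 (inord 2) * p 0 (inord 3).
(* On the pencil spanned by the rows of [Q] the Pfaffian is a binary quadratic form: either the
   first row is a zero, or its value there is a nonzero leading coefficient. *)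
have [z z0 pfz] : exists2 z : 'rV[C]_2, z != 0 & pf (z *m Q) = 0.
  have [a0|a0] := eqVneq (pf (row 0 Q)) 0.
    exists (delta_mx 0 0); last by rewrite -rowE.
    by apply/rV0Pn; exists 0; rewrite !mxE !eqxx oner_neq0.
  pose u := row 0 Q; pose v := row 1 Q.
  pose b := u 0 (inord 0) * v 0 (inord 5) + v 0 (inord 0) * u 0 (inord 5)
    - u 0 (inord 1) * v 0 (inord 4) - v 0 (inord 1) * u 0 (inord 4)
    + u 0 (inord 2) * v 0 (inord 3) + v 0 (inord 2) * u 0 (inord 3).
  have [r r0] := quadratic_root b (pf v) a0.
  exists (\row_i if i == 0 then r else 1).
    by apply/rV0Pn; exists 1; rewrite mxE oner_neq0.
  rewrite -r0 /b /pf /u /v !mxE !big_ord_recl !big_ord0 !mxE /=.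
  have -> : lift ord0 ord0 = 1 :> 'I_2 by apply: val_inj.
  by ring.
pose p := z *m Q; have p0 : p != 0 by rewrite mulmx_free_eq0.
have pF m : (p *m F) 0 m = 0.
  by rewrite (sub_kermxP (submx_trans (submxMl z Q) QF)) mxE.
have [e pe] := rV0Pn _ p0.
pose P (a b : nat) : C := p 0 (inord (index (a, b) pr)).
pose a := (nth (0, 0)%N pr e).1; pose b := (nth (0, 0)%N pr e).2.
have ab4 : (a < b < 4)%N.
  by rewrite /a /b; case: (e) => [[|[|[|[|[|[|k]]]]]]].
have Pab : P a b = p 0 e.
  congr (p 0 _); apply/val_inj; rewrite /a /b.
  by case: (e) => [[|[|[|[|[|[|k]]]]]] k6] //=; rewrite inordK.
(* The bivector [p] is decomposable, and rows [a] and [b] of its skew matrix span its plane. Their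
   only nonzero entries in columns [a] and [b] are [P a b] and its opposite, which gives the right
   inverse. *)
exists (\matrix_(i, c) alt2 P (if i == 0 then a else b) c).
{ apply/row_freeP; exists (\matrix_(c, j)
    ((if j == 0 then (c == b :> nat)%:R else - (c == a :> nat)%:R) / P a b)).
  have: P a b != 0 by rewrite Pab.
  move: (P) (a) (b) ab4 => {Pab P a b} P a b ab P0.
  apply/matrixP=> i j; rewrite !mxE; under eq_bigr do rewrite !mxE.
  rewrite !big_ord_recl !big_ord0 /= /alt2.
  case: b ab P0 => [|[|[|[|b]]]] ab P0; try by case/andP: ab.
  all: case: a ab P0 => [|[|[|a]]] ab P0; try by [].
  all: case: i => [[|[|//]] i2]; case: j => [[|[|//]] j2].
  all: by rewrite /bump -!val_eqE /=; field. }
move=> m; set X := \matrix_(i, c) _; set M := _ *m _.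
have MT : M^T = - M by rewrite /M !trmx_mul trmxK phiT mulNmx mulmxN mulmxA.
have MN i j : M i j = - M j i.
  by move/matrixP/(_ j i): MT; rewrite !mxE.
have M01 : M 0 1 = 0.
  rewrite !mxE; pose g a b : C := phi m (inord a) (inord b).
  have gE (i j : 'I_4) : phi m i j = alt2 g i j.
    rewrite -alt2E /g ?inord_val // => c d.
    by move/matrixP/(_ (inord d) (inord c)): (phiT m); rewrite !mxE.
  transitivity (\sum_(d < 4) (\sum_(c < 4) alt2 P a c * alt2 g c d) * alt2 P b d).
    apply: eq_bigr => d _; rewrite !mxE /=; congr (_ * _).
    by apply: eq_bigr => c _; rewrite !mxE gE.
  apply: (skew_sandwich ab4); first exact: pfz.
  rewrite -[RHS](pF m) mxE.
  transitivity (\sum_(k < 6) p 0 (inord k) * g (nth (0, 0)%N pr k).1 (nth (0, 0)%N pr k).2).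
    by rewrite !big_ord_recl big_ord0 /bump /P /= addr0 !addrA.
  by apply: eq_bigr => k _; rewrite [F _ _]mxE inord_val.
have Mii i : M i i = 0.
  by move/eqP: (MN i i); rewrite -addr_eq0 -mulr2n mulrn_eq0 => /eqP.
apply/matrixP=> i j; rewrite [RHS]mxE.
have ord2 (k : 'I_2) : k = 0 \/ k = 1.
  by case: k => [[|[|//]] k2]; [left | right]; apply: val_inj.
by case: (ord2 i) => ->; case: (ord2 j) => ->; rewrite ?Mii // MN M01 oppr0.
Qed.

End SkewForms.

(** * Trivectors on a 6-space annihilated by four skew forms *)

Section AlternatingContraction.
Variables (C : numClosedFieldType) (th : 'I_4 -> 'M[C]_6).
Variable w : 'I_6 -> 'I_6 -> 'I_6 -> C.
Hypothesis thT : forall m, (th m)^T = - th m.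
Hypothesis isotropic_rank : forall r (A : 'M[C]_(r, 6)),
  (forall m, A *m th m *m A^T = 0) -> (\rank A <= 2)%N.
Hypotheses (w12 : forall a b c, w a b c = - w b a c)
           (w23 : forall a b c, w a b c = - w a c b).
Hypothesis w_th : forall m i, \sum_b \sum_c w i b c * th m b c = 0.

Let f (a b c : nat) : C := w (inord a) (inord b) (inord c).

Let wE (a b c : 'I_6) : w a b c = alt3 f a b c.
Proof.
by rewrite -alt3E /f ?inord_val.
Qed.

Let thE m (a b : 'I_6) :
  th m a b = alt2 (fun x y => th m (inord x) (inord y)) a b.
Proof.
rewrite -alt2E ?inord_val // => x y.
by move/matrixP/(_ (inord y) (inord x)): (thT m); rewrite !mxE.
Qed.

Let H : 'M[C]_6 := \matrix_(i, j) hitchin f i j.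

Let H_sqr : H *m H = (hitchin_scalar f)%:M.
Proof.
apply/matrixP=> i j; rewrite !mxE -hitchin_sqr.
by apply: eq_bigr => k _; rewrite !mxE.
Qed.

Let H_skew m : H *m th m = - (th m *m H^T).
Proof.
apply/eqP; rewrite -addr_eq0; apply/eqP.
set S := _ + _.
have SE i j : S i j = \sum_k H i k * th m k j + \sum_k th m i k * H j k.
  by rewrite !mxE; congr (_ + _); apply: eq_bigr => k _; rewrite !mxE.
have Slt (i j : 'I_6) : (i < j)%N -> S i j = 0.
  move=> ij; rewrite SE.
  rewrite -[RHS](@hitchin_skew _ f (fun x y => th m (inord x) (inord y)) i j ij).
    by congr (_ + _); apply: eq_bigr => k _; rewrite -thE mxE.
  move=> k; rewrite -[RHS](w_th m k).
  by apply: eq_bigr => b _; apply: eq_bigr => c _; rewrite wE thE.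
have ST i j : S i j = - S j i.
  have th_anti x y : th m x y = - th m y x.
    by move/matrixP/(_ y x): (thT m); rewrite !mxE.
  have AB x y : \sum_k H x k * th m k y = - \sum_k th m y k * H x k.
    by rewrite -sumrN; apply: eq_bigr => k _; rewrite [in LHS]th_anti mulrN mulrC.
  by rewrite !SE !AB opprD opprK addrC.
apply/matrixP=> i j; rewrite [RHS]mxE; case: (ltngtP i j) => [ij|ji|/val_inj <-].
- exact: Slt.
- by rewrite ST Slt ?oppr0.
- by move/eqP: (ST i i); rewrite -addr_eq0 -mulr2n mulrn_eq0 => /eqP.
Qed.

(** In the expansion the terms linear in [mu] cancel by skewness, and H th H^T = - mu^2 th cancels
    the quadratic one. Thus H + mu has isotropic image for each square root [mu] of the scalar. *)
Let H_shift_isotropic mu m : mu ^+ 2 = hitchin_scalar f ->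
  (H + mu%:M) *m th m *m (H + mu%:M)^T = 0.
Proof.
move=> mu2; have thH : th m *m H^T = - (H *m th m) by rewrite H_skew opprK.
have HthH : H *m th m *m H^T = - (mu ^+ 2 *: th m).
  by rewrite -mulmxA thH mulmxN mulmxA H_sqr -mu2 mul_scalar_mx.
rewrite raddfD /= tr_scalar_mx mulmxDl mul_scalar_mx mulmxDr !mulmxDl HthH.
rewrite !mul_mx_scalar -scalemxAl thH scalerN scalerA -expr2 -opprD.
by rewrite [X in _ + X]addrC addNr.
Qed.

Let rank_shift mu : mu ^+ 2 = hitchin_scalar f -> (\rank (H + mu%:M)%R <= 2)%N.
Proof. by move=> mu2; apply: isotropic_rank => m; exact: (H_shift_isotropic m mu2). Qed.

(** For nonzero [mu], the matrix 2 mu of rank 6 would be the difference of H + mu and H - mu, both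
    of rank at most 2. *)
Let scalar0 : hitchin_scalar f = 0.
Proof.
have mu2 := sqrtCK (hitchin_scalar f); move: (sqrtC _) mu2 => mu mu2.
have [mu0|mu0] := eqVneq mu 0; first by rewrite -mu2 mu0 expr0n.
have nmu2 : (- mu) ^+ 2 = hitchin_scalar f by rewrite sqrrN.
have : \rank ((mu *+ 2)%:M : 'M[C]_6) = 6.
  by rewrite -scalemx1 mxrank_scale_nz ?mxrank1 ?mulrn_eq0.
have -> : (mu *+ 2)%:M = (H + mu%:M) + (- 1)%:M *m (H + (- mu)%:M).
  rewrite mul_scalar_mx scaleN1r opprD addrACA subrr add0r -raddfN opprK.
  by rewrite -raddfD mulr2n.
move=> r6; have := mxrank_add (H + mu%:M) ((- 1)%:M *m (H + (- mu)%:M)).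
rewrite r6 => /leq_trans/(_ (leq_add (rank_shift mu2)
  (leq_trans (mxrankM_maxr _ _) (rank_shift nmu2)))).
by [].
Qed.

Let H_add0 : H + 0%:M = H.
Proof. by apply/matrixP=> i j; rewrite !mxE mul0rn addr0. Qed.

Let HthH m : H *m th m *m H^T = 0.
Proof. by rewrite -{1 2}H_add0 H_shift_isotropic // scalar0 expr0n. Qed.

Let Hth_ker m r (N : 'M[C]_(r, 6)) : N *m H = 0 -> H *m th m *m N^T = 0.
Proof.
by move=> NH; rewrite H_skew mulNmx -mulmxA -trmx_mul NH trmx0 mulmx0 oppr0.
Qed.

(** Skewness makes the image of H orthogonal to its kernel. If the isotropic image had dimension 2,
    the kernel, of dimension 4, would contain a vector outside it, and adjoining this vector would
    give an isotropic three-space. *)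
Let rank_H_le1 : (\rank H <= 1)%N.
Proof.
rewrite leqNgt; apply/negP => rH.
have rH2 : \rank H = 2.
  by apply/eqP; rewrite eqn_leq rH; rewrite -H_add0 rank_shift // scalar0 expr0n.
have : ~~ (kermx H <= H)%MS.
  by apply/negP => /mxrankS; rewrite mxrank_ker rH2.
case/row_subPn => i Ni; set v := row i _ in Ni.
have vH : v *m H = 0 by rewrite /v -row_mul mulmx_ker row0.
suff : (\rank (col_mx H v) <= 2)%N.
  have : (H < col_mx H v)%MS.
    by rewrite ltmxE -!addsmxE addsmxSl addsmx_sub submx_refl Ni.
  rewrite ltmxErank => /andP[_].
  by rewrite rH2 ltnNge => /negPf->.
apply: isotropic_rank => m; apply: isotropic_col_mx => //.
- exact: skew_form_diag.
- exact: Hth_ker.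
Qed.

(** If the image were a line [u], the kernel would have dimension 5 and contain a 4-space [B]
    independent of [u]. A plane of [B] isotropic for the four forms, together with [u], would be an
    isotropic three-space. *)
Let H0 : H = 0.
Proof.
apply/eqP; rewrite -mxrank_eq0 -leqn0 leqNgt; apply/negP => rH0.
have rH : \rank H = 1%N by apply/eqP; rewrite eqn_leq rank_H_le1.
have [u ufree uH] := exists_row_free_sub rH0.
have eq_uH : (u == H)%MS.
  by rewrite -(geq_leqif (mxrank_leqif_eq uH)) rH (eqP ufree).
have [B Bfree BN] : exists2 B : 'M[C]_(4, 6), row_free B &
    (B <= kermx H :\: u)%MS.
  apply: exists_row_free_sub.
  have := mxrank_cap_compl (kermx H) u.
  have := mxrankS (capmxSr (kermx H) u).
  rewrite mxrank_ker rH (eqP ufree); lia.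
pose phi m := B *m th m *m B^T.
have phiT m : (phi m)^T = - phi m.
  by rewrite /phi !trmx_mul trmxK thT mulNmx mulmxN mulmxA.
have [X Xfree Xphi] := four_skew_forms phiT.
have XBN : (X *m B <= kermx H)%MS.
  by rewrite (submx_trans (submxMl _ _)) // (submx_trans BN) ?diffmxSl.
suff : (\rank (col_mx u (X *m B)) <= 2)%N.
  rewrite -addsmxE mxrank_disjoint_sum.
    by rewrite (eqP ufree) mxrankMfree // (eqP Xfree).
  apply/eqP; rewrite -submx0 capmxC.
  rewrite (submx_trans (capmxS (submx_trans (submxMl X B) BN) (submx_refl u))) //.
  by rewrite capmx_diff.
have [D uD] := submxP uH.
apply: isotropic_rank => m; apply: isotropic_col_mx => //.
- exact: skew_form_diag.
- by rewrite trmx_mul mulmxA -[_ *m B *m _]mulmxA; have := Xphi m; rewrite /phi !mulmxA.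
- rewrite uD -!mulmxA [H *m _]mulmxA Hth_ker ?mulmx0 //; exact/sub_kermxP.
Qed.

Let three_term i a b c d :
  w i a b * w i c d - w i a c * w i b d + w i a d * w i b c = 0.
Proof.
rewrite !wE; apply: hitchin0_three_term => //= x y x6 y6.
by move/matrixP/(_ (Ordinal x6) (Ordinal y6)): H0; rewrite !mxE.
Qed.

Let w_eq0 a b : w a a b = 0 /\ w b a a = 0 /\ w a b a = 0.
Proof.
have eq0 x : x = - x -> x = 0 :> C.
  by move/eqP; rewrite -addr_eq0 -mulr2n mulrn_eq0 => /eqP.
have aab : w a a b = 0 by apply: eq0; exact: w12.
have baa : w b a a = 0 by apply: eq0; exact: w23.
by split=> //; split=> //; rewrite w12 baa oppr0.
Qed.

(** By the three-term relation with common index [y], twice the sum is [w x y z] times the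
    contraction of w with [th m] at [y], which is zero. *)
Let pair_isotropic x y z m : \sum_l (\sum_k w x y k * th m k l) * w y z l = 0.
Proof.
set S := LHS; suff : S + S = 0.
  by rewrite -mulr2n => /eqP; rewrite mulrn_eq0 => /eqP.
have -> : S + S = \sum_k \sum_l w x y z * (w y k l * th m k l).
  have E : S = \sum_k \sum_l w x y k * th m k l * w y z l.
    by rewrite exchange_big; apply: eq_bigr => l _; rewrite mulr_suml.
  rewrite {2}E /S -big_split; apply: eq_bigr => k _.
  rewrite mulr_suml -big_split; apply: eq_bigr => l _ /=.
  have -> : th m l k = - th m k l.
    by move/matrixP/(_ k l): (thT m); rewrite !mxE.
  have := three_term y x k z l.
  rewrite (w12 x y k) (w12 x y l) (w12 x y z) (w23 y z k) => e.
  apply/eqP; rewrite -subr_eq0; apply/eqP.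
  transitivity (- th m k l * (w y x k * w y z l - w y x z * w y k l
    + w y x l * w y k z)); first by ring.
  by rewrite e mulr0.
under eq_bigr do rewrite -mulr_sumr.
by rewrite -mulr_sumr w_th mulr0.
Qed.

(** The vectors w(a, b, -), w(b, c, -), w(c, a, -) span an isotropic space. Their coordinates at c,
    a, b form the scalar matrix w(a, b, c), so they are independent unless it is zero. *)
Lemma alternating_contraction_eq0 a b c : w a b c = 0.
Proof.
apply/eqP/negPn/negP => wabc.
pose A : 'M[C]_(3, 6) := \matrix_(i, k)
  if i == 0 then w a b k else if i == 1 then w b c k else w c a k.
have ord3 (i : 'I_3) : [\/ i = 0, i = 1 | i = 2].
  by case: i => [[|[|[|//]]] i3];
    [constructor 1 | constructor 2 | constructor 3]; apply: val_inj.
have : (\rank A <= 2)%N.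
  apply: isotropic_rank => m; set M := _ *m _.
  have MT : M^T = - M by rewrite /M !trmx_mul trmxK thT mulNmx mulmxN mulmxA.
  have MN i j : M i j = - M j i by move/matrixP/(_ j i): MT; rewrite !mxE.
  have Mii i : M i i = 0.
    by move/eqP: (MN i i); rewrite -addr_eq0 -mulr2n mulrn_eq0 => /eqP.
  have ME i j : M i j = \sum_l (\sum_k A i k * th m k l) * A j l.
    by rewrite mxE; apply: eq_bigr => l _; rewrite !mxE.
  have M01 : M 0 1 = 0.
    rewrite ME -[RHS](pair_isotropic a b c m); apply: eq_bigr => l _.
    by rewrite [A 1 l]mxE; congr (_ * _); apply: eq_bigr => k _; rewrite mxE.
  have M12 : M 1 2 = 0.
    rewrite ME -[RHS](pair_isotropic b c a m); apply: eq_bigr => l _.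
    by rewrite [A 2 l]mxE; congr (_ * _); apply: eq_bigr => k _; rewrite mxE.
  have M20 : M 2 0 = 0.
    rewrite ME -[RHS](pair_isotropic c a b m); apply: eq_bigr => l _.
    by rewrite [A 0 l]mxE; congr (_ * _); apply: eq_bigr => k _; rewrite mxE.
  apply/matrixP=> i j; rewrite [RHS]mxE.
  by case: (ord3 i) => ->; case: (ord3 j) => ->;
    rewrite ?Mii ?M01 ?M12 ?M20 // MN ?M01 ?M12 ?M20 oppr0.
pose col (j : 'I_3) := if j == 0 then c else if j == 1 then a else b.
have AY : A *m (\matrix_(k, j) (k == col j)%:R) = (w a b c)%:M.
  apply/matrixP=> i j; rewrite !mxE (bigD1 (col j)) //= big1 => [|k /negPf kj].
    rewrite !mxE eqxx mulr1 addr0.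
    have [_ [_ aba]] := w_eq0 a b; have [_ [abb _]] := w_eq0 b a.
    have [_ [_ bcb]] := w_eq0 b c; have [_ [bcc _]] := w_eq0 c b.
    have [_ [caa _]] := w_eq0 a c; have [_ [_ cac]] := w_eq0 c a.
    have bca : w b c a = w a b c by rewrite w23 w12 opprK.
    have cab : w c a b = w a b c by rewrite w12 w23 opprK.
    by case: (ord3 i) => ->; case: (ord3 j) => ->;
      rewrite /col /= ?mulr1n ?mulr0n ?aba ?abb ?bcb ?bcc ?caa ?cac ?bca ?cab.
  by rewrite [X in _ * X]mxE kj mulr0.
have := mxrankM_maxl A (\matrix_(k, j) (k == col j)%:R).
by rewrite AY -scalemx1 mxrank_scale_nz // mxrank1 => /leq_trans h /h.
Qed.

End AlternatingContraction.

(** * Isotropic subspaces of the special trivector *)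

Section IsotropicSubspaces.

Lemma det_mx33 (A : comNzRingType) (M : 'M[A]_3) :
  \det M = M 0 0 * (M 1 1 * M 2 2 - M 1 2 * M 2 1)
    - M 0 1 * (M 1 0 * M 2 2 - M 1 2 * M 2 0)
    + M 0 2 * (M 1 0 * M 2 1 - M 1 1 * M 2 0).
Proof.
have [h ME] : exists h : nat -> nat -> A, forall i j, M i j = h i j.
  by exists (fun i j => M (inord i) (inord j)) => i j; rewrite !inord_val.
do 2 rewrite !(expand_det_row _ ord0) !big_ord_recl !big_ord0 /cofactor.
rewrite !det_mx11 !mxE !ME /= /bump /= !exprS !expr0.
by ring.
Qed.

Lemma trievalD (A : comNzRingType) n (s t : trivector A n) u v w :
  trieval (s + t) u v w = trieval s u v w + trieval t u v w.
Proof.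
rewrite /trieval -big_split; apply: eq_bigr => a _.
rewrite -big_split; apply: eq_bigr => b _.
by rewrite -big_split; apply: eq_bigr => c _; rewrite ffunE mulrDl.
Qed.

Definition det3 (A : comNzRingType) (u v w : nat -> A) (i j k : nat) : A :=
  u i * (v j * w k - v k * w j) - u j * (v i * w k - v k * w i)
  + u k * (v i * w j - v j * w i).

Definition coords (A : comNzRingType) n (u : 'rV[A]_n.+1) (i : nat) : A :=
  u 0 (inord i).

Lemma trieval_wedge3 (A : comNzRingType) n (i j k : 'I_n.+1) (u v w : 'rV[A]_n.+1) :
  trieval (wedge3 A i j k) u v w = det3 (coords u) (coords v) (coords w) i j k.
Proof.
have collapse (i' j' k' : 'I_n.+1) : \sum_a \sum_b \sum_c
    (i' == a)%:R * (j' == b)%:R * (k' == c)%:R * (u 0 a * v 0 b * w 0 c)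
    = u 0 i' * v 0 j' * w 0 k'.
  rewrite (bigD1 i') //= [X in _ + X]big1 => [|a /negPf]; last first.
    by rewrite eq_sym => ai; rewrite big1 // => b _; rewrite big1 // => c _; rewrite ai !mul0r.
  rewrite (bigD1 j') //= [X in _ + X + _]big1 => [|b /negPf]; last first.
    by rewrite eq_sym => ai; rewrite big1 // => c _; rewrite ai mulr0 !mul0r.
  rewrite (bigD1 k') //= [X in _ + X + _ + _]big1 => [|c /negPf]; last first.
    by rewrite eq_sym => ai; rewrite ai mulr0 !mul0r.
  by rewrite !eqxx !mul1r !addr0.
transitivity (\sum_a \sum_b \sum_c
   ((i == a)%:R * (j == b)%:R * (k == c)%:R * (u 0 a * v 0 b * w 0 c)
  - (i == a)%:R * (k == b)%:R * (j == c)%:R * (u 0 a * v 0 b * w 0 c)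
  + (j == a)%:R * (k == b)%:R * (i == c)%:R * (u 0 a * v 0 b * w 0 c)
  - (j == a)%:R * (i == b)%:R * (k == c)%:R * (u 0 a * v 0 b * w 0 c)
  + (k == a)%:R * (i == b)%:R * (j == c)%:R * (u 0 a * v 0 b * w 0 c)
  - (k == a)%:R * (j == b)%:R * (i == c)%:R * (u 0 a * v 0 b * w 0 c))).
  apply: eq_bigr => a _; apply: eq_bigr => b _; apply: eq_bigr => c _.
  by rewrite ffunE det_mx33 !mxE !(tnth_nth i) /=; ring.
under eq_bigr do under eq_bigr do rewrite !(sumrB, big_split) /=.
under eq_bigr do rewrite !(sumrB, big_split) /=.
rewrite !(sumrB, big_split) /= !collapse /det3 /coords !inord_val.
by ring.
Qed.

Lemma trieval_sigma0 (A : comNzRingType) (u v w : 'rV[A]_10) :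
  let D := det3 (coords u) (coords v) (coords w) in
  trieval (sigma0 A) u v w =
    D 0 2 5 + D 1 3 6 + D 2 4 7 + D 3 0 8 + D 4 1 9
    + D 0 9 7 + D 1 5 8 + D 2 6 9 + D 3 7 5 + D 4 8 6.
Proof. by rewrite /= !trievalD !trieval_wedge3. Qed.

Lemma linx_mod5 (C : numFieldType) (g : nat -> nat -> nat -> C) i d :
  linx g i d = linx g (i %% 5) d.
Proof. by rewrite /linx /x_ /y_ !modnDml modn_mod. Qed.

Lemma liny_mod5 (C : numFieldType) (g : nat -> nat -> nat -> C) i d :
  liny g i d = liny g (i %% 5) d.
Proof. by rewrite /liny /x_ /y_ !modnDml modn_mod. Qed.

(** Contracting p /\ q /\ r with sigma0(-, -, e) gives sigma0(q, r, e) p - sigma0(p, r, e) q +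
    sigma0(p, q, e) r, where every coefficient vanishes. The basis vectors e_i and e_(5+i) yield
    [linx] and [liny]; the free index [d] may be any natural number. *)
Lemma isotropic_minors_det3 (C : numFieldType) (u : 'I_3 -> 'rV[C]_10) :
  (forall i j y, trieval (sigma0 C) (u i) (u j) y = 0) ->
  isotropic_minors (det3 (coords (u 0)) (coords (u 1)) (coords (u 2))).
Proof.
move=> u_iso.
have coords_delta c k : (c < 10)%N -> (k < 10)%N ->
    coords (delta_mx 0 (inord c) : 'rV[C]_10) k = (k == c)%:R.
  by move=> c10 k10; rewrite /coords mxE eqxx -val_eqE /= !inordK.
have iso i j c (c10 : (c < 10)%N) := u_iso i j (delta_mx 0 (inord c)).
have comb (a b c x y z e : C) : x = 0 -> y = 0 -> z = 0 ->
  e = a * x - b * y + c * z -> e = 0.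
  by move=> -> -> -> ->; rewrite !mulr0 subr0 addr0.
pose p := coords (u 0); pose q := coords (u 1); pose r := coords (u 2).
split; rewrite -/p -/q -/r.
- by move=> a b c; rewrite /det3; ring.
- by move=> a b c; rewrite /det3; ring.
- move=> i d; rewrite linx_mod5.
  have := ltn_pmod i (isT : (0 < 5)%N); move: (i %% 5)%N => {}i i5.
  have i10 : (i < 10)%N by case: i i5 => [|[|[|[|[|]]]]].
  apply: (comb (p d) (q d) (r d) _ _ _ _ (iso 1 2 _ i10) (iso 0 2 _ i10) (iso 0 1 _ i10)).
  rewrite !trieval_sigma0 /linx /x_ /y_ /det3 !coords_delta // -/p -/q -/r.
  by case: i i5 {i10} => [|[|[|[|[|//]]]]] _ /=; ring.
- move=> i d; rewrite liny_mod5.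
  have := ltn_pmod i (isT : (0 < 5)%N); move: (i %% 5)%N => {}i i5.
  have i10 : (5 + i < 10)%N by case: i i5 => [|[|[|[|[|]]]]].
  apply: (comb (p d) (q d) (r d) _ _ _ _ (iso 1 2 _ i10) (iso 0 2 _ i10) (iso 0 1 _ i10)).
  rewrite !trieval_sigma0 /liny /x_ /y_ /det3 !coords_delta // -/p -/q -/r.
  by case: i i5 {i10} => [|[|[|[|[|//]]]]] _ /=; ring.
- by move=> a b c d e; rewrite /three_term /det3; ring.
Qed.

Definition contraction_mx (A : comNzRingType) n (t : trivector A n) (y : 'rV[A]_n) :
  'M[A]_n := \matrix_(a, b) \sum_c t (a, b, c) * y 0 c.

Lemma trieval_rows (A : comNzRingType) n (t : trivector A n) y r s
    (U : 'M[A]_(r, n)) (V : 'M_(s, n)) i j :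
  trieval t (row i U) (row j V) y = (U *m contraction_mx t y *m V^T) i j.
Proof.
rewrite mxE /trieval exchange_big; apply: eq_bigr => b _.
rewrite [(U *m _) _ _]mxE mulr_suml; apply: eq_bigr => a _.
rewrite [contraction_mx _ _ _ _]mxE mulr_sumr mulr_suml; apply: eq_bigr => c _.
by rewrite !mxE; ring.
Qed.

(** Three independent rows have a nonzero 3 x 3 minor, whereas all Pluecker coordinates of an
    isotropic three-space vanish. *)
Lemma sigma0_isotropic_rank (C : numClosedFieldType) r (U : 'M[C]_(r, 10)) :
  (forall y, U *m contraction_mx (sigma0 C) y *m U^T = 0) -> (\rank U <= 2)%N.
Proof.
move=> Uiso; rewrite leqNgt; apply/negP => /exists_row_free_sub[Q Qfree].
move=> /submxP[D QD].
have /isotropic_minors_det3 minors :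
    forall i j y, trieval (sigma0 C) (row i Q) (row j Q) y = 0.
  move=> i j y; rewrite trieval_rows QD trmx_mul !mulmxA -[D *m U *m _]mulmxA.
  by rewrite -[D *m _ *m _]mulmxA Uiso mulmx0 mul0mx mxE.
have QT : row_full Q^T by rewrite /row_full mxrank_tr.
have := fullrowsub_unit QT; rewrite unitmxE det_mx33 !mxE.
set f := fullrankfun QT.
have := isotropic_minors_vanish minors (ltn_ord (f 0)) (ltn_ord (f 1)) (ltn_ord (f 2)).
rewrite /det3 /coords !mxE !inord_val => e.
rewrite [X in X \is a GRing.unit](_ : _ = 0) ?unitr0 // -[RHS]e.
by ring.
Qed.

End IsotropicSubspaces.

(** * Affine charts of the Grassmannian *)

Section Charts.
Variables (K : closedFieldType) (k m : nat).
Implicit Types (s : 'S_(k + m)) (X : 'M[K]_(k, m)).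

Lemma exists_perm_extending (T : finType) (I : finType) (f g : I -> T) :
  injective f -> injective g -> exists s : {perm T}, forall i, s (f i) = g i.
Proof.
move=> f_inj g_inj.
suff [s sP] : exists s : {perm T}, forall i, i \in enum I -> s (f i) = g i.
  by exists s => i; rewrite sP ?mem_enum.
elim: (enum I) => [|x r [s sP]]; first by exists 1%g.
have [xr|xr] := boolP (x \in r).
  by exists s => i; rewrite inE => /predU1P[->|]; exact: sP.
exists (s * tperm (s (f x)) (g x))%g => i; rewrite permM inE.
case/predU1P=> [->|ir]; first by rewrite tpermL.
rewrite (sP i ir) tpermD //.
  by rewrite -(sP i ir) (inj_eq perm_inj) (inj_eq f_inj); apply: contraNneq xr => ->.
by rewrite (inj_eq g_inj); apply: contraNneq xr => ->.
Qed.

Lemma chart_mx_row_free s X : row_free (chart_mx s X).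
Proof.
rewrite /chart_mx col_permE /row_free mxrankMfree ?row_free_unit ?unitmx_perm //.
by apply/row_freeP; exists (col_mx 1%:M 0); rewrite mul_row_col mulmx0 addr0 mulmx1.
Qed.

(** These rows represent a basis of the quotient by any subspace of the chart, and they are the
    directions in which the chart coordinates move a row of [chart_mx]. *)
Definition chart_complement s : 'M[K]_(m, k + m) := col_perm s (row_mx 0 1%:M).

Lemma chart_complement_full s X : row_full (col_mx (chart_mx s X) (chart_complement s)).
Proof.
rewrite /chart_mx /chart_complement !col_permE -mul_col_mx.
rewrite row_full_unit unitmx_mul unitmx_perm andbT unitmxE.
rewrite -[col_mx _ _]/(block_mx 1%:M X 0 1%:M) det_ublock !det1 mulr1.
exact: unitr1.
Qed.

Lemma mulmx_in_span_rows n r (U : 'M[K]_(r, n)) (u : 'rV_r) :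
  u *m U \in <<[seq row i U | i : 'I_r]>>%VS.
Proof.
rewrite mulmx_sum_row; apply: memv_suml => i _; apply/memvZ/memv_span.
by apply: map_f; rewrite mem_enum.
Qed.

(** A basis matrix has an invertible maximal minor; [s] carries its columns to the first [k] places,
    and the inverse of the minor normalises the basis. *)
Lemma exists_chart (W : {vspace 'rV[K]_(k + m)}) : \dim W = k ->
  exists s p, W = chart_point s p.
Proof.
move=> dimW.
have [b bW] : exists b : k.-tuple 'rV[K]_(k + m), basis_of W b.
  by exists (tcast dimW (vbasis W)); rewrite val_tcast vbasisP.
pose U : 'M[K]_(k, k + m) := \matrix_i b`_i.
have WU : W = <<[seq row i U | i : 'I_k]>>%VS.
  rewrite -{1}(span_basis bW); congr <<_>>%VS.
  apply: (@eq_from_nth _ 0) => [|i].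
    by rewrite size_tuple size_map -cardE card_ord.
  rewrite size_tuple => ik.
  rewrite (nth_map (Ordinal ik)) -?cardE ?card_ord // rowK; congr _`_ _.
  by rewrite nth_enum_ord.
have Ufree : row_free U.
  apply: inj_row_free => v; rewrite mulmx_sum_row => v0.
  apply/rowP=> i; rewrite [RHS]mxE.
  move/freeP: (basis_free bW) => bfree; apply: (bfree (fun j => v 0 j)).
  by rewrite -[RHS]v0; apply: eq_bigr => j _; rewrite rowK.
have UT : row_full U^T by rewrite /row_full mxrank_tr.
pose f := fullrankfun UT.
have [s sf] := exists_perm_extending (@fullrankfun_inj _ _ _ _ UT) (@lshift_inj k m).
pose Y := col_perm s^-1 U; pose L := lsubmx Y.
have Lunit : L \in unitmx.
  rewrite -unitmx_tr; have := fullrowsub_unit UT.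
  suff -> : L^T = rowsub (fullrankfun UT) U^T by [].
  by apply/matrixP=> i j; rewrite !mxE -(sf i) permK.
pose X := invmx L *m rsubmx Y.
have chartU : chart_mx s X = invmx L *m U.
  rewrite /chart_mx /X -{1}(mulVmx Lunit) -mul_mx_row hsubmxK.
  rewrite col_permE -mulmxA -col_permE; congr (_ *m _).
  by apply/matrixP=> i j; rewrite !mxE permK.
exists s, (mxvec X 0).
have -> : chart_point s (mxvec X 0) = <<[seq row i (chart_mx s X) | i : 'I_k]>>%VS.
  rewrite /chart_point; congr <<_>>%VS; apply: eq_map => i; congr (row i (chart_mx s _)).
  by apply/matrixP=> x y; rewrite mxE mxvecE.
apply/eqP; rewrite {1}WU chartU; apply/eqP.
apply/subv_anti/andP; split; apply/span_subvP => _ /mapP[i _ ->].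
  have -> : row i U = row i L *m (invmx L *m U) by rewrite -row_mul mulKVmx.
  exact: mulmx_in_span_rows.
by rewrite row_mul; exact: mulmx_in_span_rows.
Qed.
End Charts.

(** * Smoothness in terms of trivectors on the subspace *)

Section JacobianCriterion.
Variables (K : closedFieldType) (k m : nat).
Implicit Types (s : 'S_(k + m)) (t : trivector K (k + m)).
Local Notation triple := ('I_k * 'I_k * 'I_k)%type.

Definition increasing_triples : seq triple :=
  [seq abc : triple <- enum {: triple} | (abc.1.1 < abc.1.2 < abc.2)%N].

Lemma trieval_mderiv t n (u v w : 'rV[{mpoly K[n]}]_(k + m)) (e : 'I_n) (p : 'I_n -> K) :
  let d (r : 'rV[{mpoly K[n]}]_(k + m)) := map_mx (fun q => q^`M(e).@[p]) r in
  let ev (r : 'rV[{mpoly K[n]}]_(k + m)) := map_mx (meval p) r in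
  (trieval [ffun abc => (t abc)%:MP_[n]] u v w)^`M(e).@[p] =
    trieval t (d u) (ev v) (ev w) + trieval t (ev u) (d v) (ev w)
    + trieval t (ev u) (ev v) (d w).
Proof.
have dev_sum I (r : seq I) (F : I -> {mpoly K[n]}) :
    (\sum_(i <- r) F i)^`M(e).@[p] = \sum_(i <- r) (F i)^`M(e).@[p].
  apply: (big_morph (fun q => q^`M(e).@[p])) => [q q'|].
    by rewrite mderivD mevalD.
  by rewrite mderiv0 meval0.
rewrite /= /trieval -!big_split !dev_sum; apply: eq_bigr => a _.
rewrite /= -!big_split !dev_sum; apply: eq_bigr => b _.
rewrite /= -!big_split !dev_sum; apply: eq_bigr => c _.
rewrite ffunE !mderivM mderivC mul0r add0r !(mevalD, mevalM) mevalC !mxE /=.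
by ring.
Qed.

Lemma trievalZ t (x : K) u v w : trieval t (x *: u) v w = x * trieval t u v w.
Proof.
rewrite /trieval mulr_sumr; apply: eq_bigr => a _.
rewrite mulr_sumr; apply: eq_bigr => b _.
by rewrite mulr_sumr; apply: eq_bigr => c _; rewrite mxE; ring.
Qed.

Lemma generic_mx_meval s (p : 'I_(k * m) -> K) a :
  map_mx (meval p) (row a (generic_mx K s)) =
  row a (chart_mx s (\matrix_(i, j) p (mxvec_index i j))).
Proof.
apply/rowP=> x; rewrite !mxE; case: (split _) => y; rewrite !mxE.
  by rewrite rmorph_nat.
by rewrite mevalXU.
Qed.

Lemma generic_mx_mderiv s (p : 'I_(k * m) -> K) a l j :
  map_mx (fun q => q^`M(mxvec_index l j).@[p]) (row a (generic_mx K s)) =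
  (a == l)%:R *: row j (chart_complement K s).
Proof.
apply/rowP=> x; rewrite !mxE; case: (split _) => y; rewrite !mxE.
  by rewrite -mpolyC_nat mderivC meval0 mulr0.
have index_inj : (mxvec_index a y == mxvec_index l j) = (a == l) && (y == j).
  rewrite /mxvec_index (inj_eq (@cast_ord_inj _ _ _)) (inj_eq enum_rank_inj).
  by rewrite xpair_eqE.
rewrite mderivX mnm1E index_inj mevalZ [j == y]eq_sym -natrM mulnb.
case: andP => [[/eqP-> /eqP->]|_]; last by rewrite !mul0r.
by rewrite -{1}[U_(_)%MM]addm0 addmC addmK mpolyX0 meval1 mulr1.
Qed.

(** The chart coordinate (l, j) moves row [l] of V along row [j] of E. A linear relation between the
    rows of the Jacobian is a trivector on V, and testing it on these directions says that its
    contraction with each form t(-, -, E_j) vanishes. If this forces it to be zero, the chart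
    equations themselves are the generators required by [smooth_at]. *)
Lemma smooth_zero_locus_criterion t d :
  (forall u v w, trieval t u v w = - trieval t v u w) ->
  (forall u v w, trieval t u v w = - trieval t u w v) ->
  (size increasing_triples + d = k * m)%N ->
  (exists W, zero_locus t W) ->
  (forall (V : 'M[K]_(k, k + m)) (E : 'M_(m, k + m)) (w : 'I_k -> 'I_k -> 'I_k -> K),
    row_free V -> row_full (col_mx V E) ->
    (forall a b c, trieval t (row a V) (row b V) (row c V) = 0) ->
    (forall a b c, w a b c = - w b a c) -> (forall a b c, w a b c = - w a c b) ->
    (forall l j, \sum_b \sum_c w l b c * trieval t (row b V) (row c V) (row j E) = 0) ->
    forall a b c, w a b c = 0) ->
  smooth_zero_locus t d.
Proof.
move=> t12 t23 szd Wex crit; split=> // W [dimW Wt].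
have [s [p Wp]] := exists_chart dimW; exists s, p; split=> //.
set gs := chart_equations t s.
have sz_gs : size gs = size increasing_triples by rewrite size_map.
exists gs; split; first by rewrite sz_gs.
  have in_self f : f \in gs -> in_ideal gs (1 * f).
    move=> fgs; have i_lt : (index f gs < size gs)%N by rewrite index_mem.
    exists (fun i => (i == Ordinal i_lt)%:R).
    rewrite (bigD1 (Ordinal i_lt)) //= big1 => [|i /negPf->]; last by rewrite mul0r.
    by rewrite eqxx addr0 nth_index.
  by exists 1; split=> //; rewrite meval1 oner_neq0.
set V := chart_mx s (\matrix_(i, j) p (mxvec_index i j)).
pose E := chart_complement K s.
have V0 a b c : trieval t (row a V) (row b V) (row c V) = 0.
  have VW i : row i V \in W.
    rewrite Wp; apply: memv_span; apply: map_f; exact: mem_enum.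
  exact: Wt.
apply: inj_row_free => u uJ.
pose tr0 (i : 'I_(size gs)) := tnth (in_tuple increasing_triples) (cast_ord sz_gs i).
have trs_uniq : uniq (in_tuple increasing_triples) by rewrite filter_uniq ?enum_uniq.
have tr0_inj : injective tr0.
  by move=> i i' /(elimT (tuple_uniqP _) trs_uniq)/cast_ord_inj.
have tr0_incr i : ((tr0 i).1.1 < (tr0 i).1.2 < (tr0 i).2)%N.
  have := mem_tnth (cast_ord sz_gs i) (in_tuple increasing_triples).
  by rewrite mem_filter => /andP[].
(* [cc] extends the relation [u] by zero to all triples; its antisymmetrisation [w] still agrees
   with [u] on increasing triples. *)
pose cc (abc : triple) : K := \sum_i (tr0 i == abc)%:R * u 0 i.
have cc_tr i : cc (tr0 i) = u 0 i.
  rewrite /cc (bigD1 i) //= eqxx mul1r big1 ?addr0 // => j ji.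
  by rewrite (inj_eq tr0_inj) (negPf ji) mul0r.
have cc0 (a b c : 'I_k) : ~~ (a < b < c)%N -> cc (a, b, c) = 0.
  move=> abc; rewrite /cc big1 // => i _; case: eqP => [e|]; last by rewrite mul0r.
  by move: (tr0_incr i) abc; rewrite e => /= ->.
pose w (a b c : 'I_k) := cc (a, b, c) + cc (b, c, a) + cc (c, a, b)
  - cc (b, a, c) - cc (a, c, b) - cc (c, b, a).
have w0 : forall a b c, w a b c = 0.
  apply: (crit V E) => //; first exact: chart_mx_row_free.
  - exact: chart_complement_full.
  - by move=> a b c; rewrite /w; ring.
  - by move=> a b c; rewrite /w; ring.
  move=> l j; pose T b c := trieval t (row j E) (row b V) (row c V).
  have TC b c : T c b = - T b c by rewrite /T t23.
  pose F (a b c : 'I_k) : K := (a == l)%:R * T b c - (b == l)%:R * T a c + (c == l)%:R * T a b.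
  have t2 x v' r w' : trieval t v' (x *: r) w' = - (x * trieval t r v' w').
    by rewrite t12 trievalZ.
  have t3 x v' w' r : trieval t v' w' (x *: r) = x * trieval t r v' w'.
    by rewrite t23 t12 opprK trievalZ.
  have gsE (i : 'I_(size gs)) : (gs`_i)^`M(mxvec_index l j).@[p] =
      F (tr0 i).1.1 (tr0 i).1.2 (tr0 i).2.
    rewrite /gs /chart_equations (nth_map (tr0 i)) -/increasing_triples -?sz_gs //.
    rewrite -[nth _ _ _]/(nth (tr0 i) (in_tuple increasing_triples) (cast_ord sz_gs i)).
    rewrite -tnth_nth -/(tr0 i) trieval_mderiv !generic_mx_meval !generic_mx_mderiv -/V -/E.
    by rewrite trievalZ t2 t3 /F /T.
  have sumF : \sum_a \sum_b \sum_c cc (a, b, c) * F a b c = 0.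
    transitivity (\sum_(q : triple) cc q * F q.1.1 q.1.2 q.2).
      rewrite pair_big pair_big /=.
      by apply: eq_bigr => -[[a b] c].
    transitivity ((u *m jacobian gs p) 0 (mxvec_index l j)); last first.
      by rewrite uJ mxE.
    transitivity (\sum_(q : triple) \sum_i
        (tr0 i == q)%:R * u 0 i * F q.1.1 q.1.2 q.2).
      by apply: eq_bigr => q _; rewrite /cc mulr_suml.
    rewrite [RHS]mxE exchange_big /=; apply: eq_bigr => i _ /=.
    rewrite (bigD1 (tr0 i)) //= eqxx mul1r big1 ?addr0; first by rewrite mxE gsE.
    by move=> q /negPf qi; rewrite eq_sym qi !mul0r.
  have pick1 (I : finType) (i0 : I) (G : I -> K) : \sum_i (i == i0)%:R * G i = G i0.
    by rewrite (bigD1 i0) //= eqxx mul1r big1 ?addr0 // => i /negPf->; rewrite mul0r.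
  (* [X b c] collects the coefficients of [T b c] in the preceding sum, and w(l, b, c) = X b c - X c
     b. As [T] is alternating, the required sum is twice the one for [X]. *)
  pose X (b c : 'I_k) : K := cc (l, b, c) - cc (b, l, c) + cc (b, c, l).
  have sumX : \sum_b \sum_c X b c * T b c = 0.
    rewrite -[RHS]sumF; transitivity (\sum_b \sum_c cc (l, b, c) * T b c
      - \sum_b \sum_c cc (b, l, c) * T b c + \sum_b \sum_c cc (b, c, l) * T b c).
      rewrite -sumrB -big_split; apply: eq_bigr => b _ /=.
      by rewrite -sumrB -big_split; apply: eq_bigr => c _ /=; rewrite /X; ring.
    transitivity (\sum_a (a == l)%:R * (\sum_b \sum_c cc (a, b, c) * T b c)
      - \sum_a \sum_b (b == l)%:R * (\sum_c cc (a, b, c) * T a c)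
      + \sum_a \sum_b \sum_c (c == l)%:R * (cc (a, b, c) * T a b)).
      rewrite pick1; congr (_ - _ + _); apply: eq_bigr => b _; first by rewrite pick1.
      by apply: eq_bigr => c _; rewrite pick1.
    rewrite -sumrB -big_split; apply: eq_bigr => a _ /=.
    rewrite mulr_sumr -sumrB -big_split; apply: eq_bigr => b _ /=.
    rewrite !mulr_sumr -sumrB -big_split; apply: eq_bigr => c _ /=.
    by rewrite /F; ring.
  transitivity (\sum_b \sum_c X b c * T b c + \sum_b \sum_c X b c * T b c); last first.
    by rewrite sumX addr0.
  rewrite [X in _ = _ + X]exchange_big -big_split; apply: eq_bigr => b _ /=.
  rewrite -big_split; apply: eq_bigr => c _ /=.
  by rewrite (TC b c) (t23 (row b V)) (t12 (row b V)) -/(T b c) /w /X; ring.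
apply/rowP=> i; rewrite mxE -cc_tr.
case abcE: (tr0 i) => [[a b] c].
have abc : (a < b < c)%N by have := tr0_incr i; rewrite abcE.
have := w0 a b c; rewrite /w.
have /andP[ab bc] := abc.
rewrite (cc0 b c a) ?(cc0 c a b) ?(cc0 b a c) ?(cc0 a c b) ?(cc0 c b a) ?addr0 ?subr0 //; lia.
Qed.

End JacobianCriterion.

(** * The two zero loci of the special trivector *)

Section SpecialTrivector.

Lemma contraction_mx_mulmx (A : comNzRingType) n r (t : trivector A n)
    (z : 'rV_r) (M : 'M[A]_(r, n)) :
  contraction_mx t (z *m M) = \sum_i z 0 i *: contraction_mx t (row i M).
Proof.
apply/matrixP=> a b; rewrite summxE mxE.
transitivity (\sum_c \sum_i z 0 i * (t (a, b, c) * M i c)).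
  apply: eq_bigr => c _; rewrite mxE mulr_sumr.
  by apply: eq_bigr => i _; rewrite mulrCA.
rewrite exchange_big; apply: eq_bigr => i _; rewrite !mxE mulr_sumr.
by apply: eq_bigr => c _; rewrite mxE.
Qed.

(** It suffices to test the forms t(-, -, E_j): V and E together span, and t(-, -, v) vanishes on V
    for v in V. *)
Lemma isotropic_mulmx (K : fieldType) k m (t : trivector K (k + m))
    (V : 'M_(k, k + m)) (E : 'M_(m, k + m)) r (A : 'M[K]_(r, k)) :
  row_full (col_mx V E) ->
  (forall a b c, trieval t (row a V) (row b V) (row c V) = 0) ->
  (forall j, A *m (V *m contraction_mx t (row j E) *m V^T) *m A^T = 0) ->
  forall y, (A *m V) *m contraction_mx t y *m (A *m V)^T = 0.
Proof.
move=> VE V0 AE y; have /submxP[z ->] : (y <= col_mx V E)%MS by exact: submx_full.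
rewrite contraction_mx_mulmx trmx_mul mulmx_sumr !mulmx_suml big1 // => i _.
rewrite -scalemxAr -!scalemxAl -!mulmxA.
suff -> : V *m (contraction_mx t (row i (col_mx V E)) *m (V^T *m A^T))
  = V *m contraction_mx t (row i (col_mx V E)) *m V^T *m A^T.
  rewrite mulmxA; case: (splitP i) => j ij.
    have -> : i = lshift m j by apply: val_inj.
    suff -> : V *m contraction_mx t (row (lshift m j) (col_mx V E)) *m V^T = 0.
      by rewrite mulmx0 mul0mx scaler0.
    by apply/matrixP=> a b; rewrite -trieval_rows rowKu V0 mxE.
  have -> : i = rshift k j by apply: val_inj.
  by rewrite rowKd AE scaler0.
by rewrite !mulmxA.
Qed.

Lemma exists_coordinate_subspace (K : fieldType) k n (f : k.-tuple 'I_n) : uniq f ->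
  exists2 W : {vspace 'rV[K]_n}, \dim W = k &
    forall u, u \in W -> forall x, x \notin f -> u 0 x = 0.
Proof.
move=> f_uniq; pose e : k.-tuple 'rV[K]_n := [tuple delta_mx 0 (tnth f i) | i < k].
have eE (i : 'I_k) : e`_i = delta_mx 0 (tnth f i) by rewrite -tnth_nth tnth_mktuple.
exists <<e>>%VS.
  suff /eqP : free e by rewrite size_tuple.
  apply/freeP => c /rowP c0 i; have := c0 (tnth f i).
  rewrite summxE mxE (bigD1 i) //= big1 => [|j ji].
    by rewrite eE !mxE !eqxx mulr1 addr0.
  rewrite eE !mxE eqxx /= (inj_eq (elimT (tuple_uniqP _) f_uniq)) eq_sym.
  by rewrite (negPf ji) mulr0.
move=> u /coord_span-> x xf; rewrite summxE big1 // => i _.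
rewrite eE !mxE eqxx /=; case: eqP => [xE|]; last by rewrite mulr0.
by rewrite xE mem_tnth in xf.
Qed.

Lemma size_increasing_triples k :
  size (increasing_triples k) = (\sum_(a < k) \sum_(b < k) \sum_(c < k) (a < b < c))%N.
Proof.
rewrite pair_big pair_big /= -sum1_size big_filter big_mkcond big_enum /=.
by apply: eq_bigr => q _; case: ifP.
Qed.

Lemma trieval_sigma0_swap12 (A : comNzRingType) (u v w : 'rV[A]_10) :
  trieval (sigma0 A) u v w = - trieval (sigma0 A) v u w.
Proof. by rewrite !trieval_sigma0 /det3; ring. Qed.

Lemma trieval_sigma0_swap23 (A : comNzRingType) (u v w : 'rV[A]_10) :
  trieval (sigma0 A) u v w = - trieval (sigma0 A) u w v.
Proof. by rewrite !trieval_sigma0 /det3; ring. Qed.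

Lemma sigma0_zero_coords (A : comNzRingType) (I : seq nat) (u v w : 'rV[A]_10) :
  all (fun t => has (mem I) t)
    [:: [:: 0; 2; 5]; [:: 1; 3; 6]; [:: 2; 4; 7]; [:: 3; 0; 8]; [:: 4; 1; 9];
        [:: 0; 9; 7]; [:: 1; 5; 8]; [:: 2; 6; 9]; [:: 3; 7; 5]; [:: 4; 8; 6]]%N ->
  {in I, forall i, [/\ coords u i = 0, coords v i = 0 & coords w i = 0]} ->
  trieval (sigma0 A) u v w = 0.
Proof.
move=> hitI zI.
have D0 i j k : has (mem I) [:: i; j; k] ->
    det3 (coords u) (coords v) (coords w) i j k = 0.
  rewrite /= orbF; case/or3P => /zI[u0 v0 w0];
    by rewrite /det3 u0 v0 w0; ring.
move: hitI; rewrite trieval_sigma0 /= => /and5P[h1 h2 h3 h4].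
case/and5P => h5 h6 h7 h8 /andP[h9 /andP[h10 _]].
by rewrite !D0 // !addr0.
Qed.

Variable C : numClosedFieldType.

(** The third exterior power of a three-space is a line, so [w] is a single number. If it is
    nonzero, all the forms sigma0(-, -, E_j) vanish on V, and V is an isotropic three-space. *)
Lemma sigma0_hyperplane_section_smooth : @smooth_zero_locus C 3 7 (sigma0 C) 20.
Proof.
apply: smooth_zero_locus_criterion.
- exact: trieval_sigma0_swap12.
- exact: trieval_sigma0_swap23.
- by rewrite size_increasing_triples !big_ord_recl !big_ord0.
- have [|W dimW W0] := @exists_coordinate_subspace C 3 10 [tuple inord 0; inord 1; inord 2].
    by rewrite /= !inE -!val_eqE /= !inordK.
  exists W; split=> // u v w uW vW wW.
  apply: (@sigma0_zero_coords _ [:: 3; 4; 5; 6; 7; 8; 9]%N) => // i iI.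
  have iW : inord i \notin [tuple inord 0; inord 1; inord 2 : 'I_10].
    by move: i iI; apply/allP; rewrite /= !inE -!val_eqE /= !inordK.
  by split; apply: W0.
move=> V E w Vfree VE V0 w12 w23 wE.
pose f (x y z : nat) : C := w (inord x) (inord y) (inord z).
have wf (a b c : 'I_3) : w a b c = alt3 f a b c by rewrite -alt3E /f ?inord_val.
pose g j (x y : nat) : C :=
  trieval (sigma0 C) (row (inord x) V) (row (inord y) V) (row j E).
have gE j (b c : 'I_3) :
    trieval (sigma0 C) (row b V) (row c V) (row j E) = alt2 (g j) b c.
  by rewrite -alt2E /g ?inord_val // => x y; rewrite trieval_sigma0_swap12.
have fg0 j : [/\ f 0%N 1%N 2%N * g j 1%N 2%N = 0,
    f 0%N 1%N 2%N * g j 0%N 2%N = 0 & f 0%N 1%N 2%N * g j 0%N 1%N = 0].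
  have S (l : 'I_3) : \sum_(b < 3) \sum_(c < 3) alt3 f l b c * alt2 (g j) b c = 0.
    rewrite -[RHS](wE l j); apply: eq_bigr => b _.
    by apply: eq_bigr => c _; rewrite wf gE.
  split.
  - apply: (double_eq0 (S 0)); rewrite !big_ord_recl !big_ord0 /alt3 /alt2 /=; ring.
  - apply: (double_oppr_eq0 (S 1)); rewrite !big_ord_recl !big_ord0 /alt3 /alt2 /=; ring.
  - apply: (double_eq0 (S 2)); rewrite !big_ord_recl !big_ord0 /alt3 /alt2 /=; ring.
suff f0 : f 0%N 1%N 2%N = 0.
{ move=> [[|[|[|//]]] a3] [[|[|[|//]]] b3] [[|[|[|//]]] c3].
  all: by rewrite wf /alt3 /= ?f0 ?oppr0. }
apply/eqP/negPn/negP => f0.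
have : (\rank (1%:M *m V) <= 2)%N.
{ apply: sigma0_isotropic_rank; apply: (isotropic_mulmx VE V0) => j.
  rewrite mul1mx trmx1 mulmx1; apply/matrixP=> b c; rewrite -trieval_rows gE mxE.
  have [/eqP] := fg0 j.
  rewrite !mulf_eq0 (negPf f0) /= => /eqP g12 /eqP; rewrite mulf_eq0 (negPf f0) /= => /eqP g02.
  move=> /eqP; rewrite mulf_eq0 (negPf f0) /= => /eqP g01.
  case: b c => [[|[|[|//]]] b3] [[|[|[|//]]] c3].
  all: by rewrite /alt2 /= ?g12 ?g02 ?g01 ?oppr0. }
by rewrite mul1mx (eqP Vfree).
Qed.

Lemma sigma0_debarre_voisin_smooth : @smooth_zero_locus C 6 4 (sigma0 C) 4.
Proof.
apply: smooth_zero_locus_criterion.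
- exact: trieval_sigma0_swap12.
- exact: trieval_sigma0_swap23.
- by rewrite size_increasing_triples !big_ord_recl !big_ord0.
(* The complementary indices 3, 4, 5, 9 meet each of the ten terms of sigma0, so this coordinate
   6-space lies in the zero locus. *)
- have [|W dimW W0] := @exists_coordinate_subspace C 6 10
      [tuple inord 0; inord 1; inord 2; inord 6; inord 7; inord 8].
    by rewrite /= !inE -!val_eqE /= !inordK.
  exists W; split=> // u v w uW vW wW.
  apply: (@sigma0_zero_coords _ [:: 3; 4; 5; 9]%N) => // i iI.
  have iW : inord i \notin [tuple inord 0; inord 1; inord 2; inord 6; inord 7; inord 8 : 'I_10].
    by move: i iI; apply/allP; rewrite /= !inE -!val_eqE /= !inordK.
  by split; apply: W0.
move=> V E w Vfree VE V0 w12 w23 wE.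
pose th j := V *m contraction_mx (sigma0 C) (row j E) *m V^T.
have thE j b c : th j b c = trieval (sigma0 C) (row b V) (row c V) (row j E).
  by rewrite trieval_rows.
apply: (@alternating_contraction_eq0 C th) => //.
- by move=> j; apply/matrixP=> b c; rewrite [LHS]mxE [RHS]mxE !thE trieval_sigma0_swap12.
- move=> r A Aiso; rewrite -(mxrankMfree A Vfree).
  by apply: sigma0_isotropic_rank; apply: isotropic_mulmx VE V0 Aiso.
- move=> j l; rewrite -[RHS](wE l j); apply: eq_bigr => b _.
  by apply: eq_bigr => c _; rewrite thE.
Qed.

End SpecialTrivector.

Theorem proposition3p2 (R : realType) :
  @smooth_zero_locus R[i] 3 7 (sigma0 R[i]) 20 /\
  @smooth_zero_locus R[i] 6 4 (sigma0 R[i]) 4.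
Proof.
split; first exact: sigma0_hyperplane_section_smooth.
exact: sigma0_debarre_voisin_smooth.
Qed.
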